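(* Let $\varepsilon>0$ be fixed. As $p\to\infty$ through primes, for every $U\ge p^{\frac12 e^{-1/2}+\varepsilon}$, for all but $o(p)$ integers $a\in\{0,\ldots,p-1\}$ with $\gcd(a,p)=1$ there exist integers $u_1,\ldots,u_7$ with $$q_p(u_1)+\cdots+q_p(u_7)\equiv a\pmod p,\qquad 1\le u_1,\ldots,u_7\le U,$$ where $q_p$ is the Fermat quotient modulo $p$.
   Context: For a prime $p$ and an integer $u$ with $\gcd(u,p)=1$, the Fermat quotient $q_p(u)$ is the unique integer with $q_p(u)\equiv \frac{u^{p-1}-1}{p} \pmod p$ and $0\le q_p(u)\le p-1$. For integers divisible by $p$ one sets $q_p(kp)=0$, $k\in\mathbb{Z}$. *)

(* Defs.v *)
From mathcomp Require Import all_boot all_order all_algebra.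
From mathcomp Require Import all_classical all_reals all_analysis.

Set Implicit Arguments.
Unset Strict Implicit.
Unset Printing Implicit Defensive.

Import Order.TTheory GRing.Theory Num.Theory.

Local Open Scope ring_scope.

(* For p prime and p not dividing u, the division by p is exact, and the
   remainder [%%] is the representative in {0, ..., p - 1}. *)
Definition fermat_quotient (p : nat) (u : int) : int :=
  if (p %| u)%Z then 0 else (((u ^+ p.-1 - 1) %/ p)%Z %% p)%Z.

Definition fq_sum_representable (R : realType) (p : nat) (U : R) (k : nat)
    (a : int) : Prop :=
  exists u : 'I_k -> int,
    (\sum_(i < k) fermat_quotient p (u i) = a %[mod p])%Z /\
    (forall i : 'I_k, 1 <= u i /\ (u i)%:~R <= U).

Definition fq_exceptions (R : realType) (p : nat) (U : R) (k : nat) :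
    {set 'I_p} :=
  finset (fun a : 'I_p =>
    coprime a p && `[< ~ fq_sum_representable p U k (Posz a) >]).

(* Main.v *)
(** Modulo [p] the Fermat quotient is a homomorphism from the units modulo
    [p^2], so the task is to write almost every class as the quotient of a
    product of seven integers [<= U].  Put [P ~ p^(1/K)], [N ~ p^(1/2 + 2/K)],
    and consider products [n1 n2 v1 ... vk] with [ni <= N], [vi <= P].  If [n1]
    and [n2] are [U]-smooth such a product splits into seven factors [<= U]:
    each [ni <= U^2] packs into three bins, and the tiny [vi] fill the gaps,
    because [U^7] exceeds [p^2] by a fixed power ([e^(-1/2) > 4/7]).

    By Mertens more than half of the [n <= N] are smooth, this being where
    [e^(-1/2)] comes from.  As [1_A 1_B >= 1_A + 1_B - 1], the smooth pairs are
    bounded below by a count in which [n2] ranges over all integers and [n1]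
    carries the sign [+1] (smooth) or [-1].  The Fourier transform of that
    count is [G S W^k], where [S] is a sum over a full interval of length [N]
    and [W] one of length [P].  The characters for which [W] is not small are
    few by the large sieve, and for these Burgess's method bounds [S]; for the
    others the large sieve bounds [G S W^(k-1)].  Modulo [p^2] the complete
    sums in Burgess's method are elementary, since [q(y + p z) = q(y) - z / y]
    is linear in [z].  The variance of the count is thus small, so it is
    positive outside [o(p)] classes. *)
Require Import Defs.
From mathcomp Require Import all_boot all_order all_algebra.
From mathcomp Require Import all_classical all_reals all_analysis.
From mathcomp Require Import complex ring lra zify.

Set Implicit Arguments.
Unset Strict Implicit.
Unset Printing Implicit Defensive.

Import Order.TTheory GRing.Theory Num.Theory.

Local Open Scope ring_scope.

(** * Divisor bound *)

Section DivisorBound.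
Local Open Scope nat_scope.

Definition ndiv (x : nat) : nat := size (divisors x).

(** Each divisor [d] is [q ^ i * z] with [i = minn e (logn q d)] and [z] a divisor of [y], so the
    list of these products covers all divisors. *)
Lemma ndiv_pfactorM q e y : prime q -> 0 < y ->
  ndiv (q ^ e * y) <= e.+1 * ndiv y.
Proof.
move=> q_pr y_gt0; have q_gt0 := prime_gt0 q_pr.
have x_gt0 : 0 < q ^ e * y by rewrite muln_gt0 expn_gt0 q_gt0.
pose L := [seq q ^ i * z | i <- iota 0 e.+1, z <- divisors y].
have -> : e.+1 * ndiv y = size L by rewrite size_allpairs size_iota.
apply: uniq_leq_size; first exact: divisors_uniq.
move=> d; rewrite -dvdn_divisors // => d_dvd.
have d_gt0 : 0 < d := dvdn_gt0 x_gt0 d_dvd.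
set i := minn e (logn q d).
apply/allpairsP; exists (i, d %/ q ^ i) => /=.
have qi_d : q ^ i %| d by rewrite pfactor_dvdn // geq_minr.
split; last by rewrite mulnC divnK.
- by rewrite -[_ :: _]/(iota 0 e.+1) mem_iota /= add0n ltnS geq_minl.
rewrite -dvdn_divisors //.
have [le_e|lt_e] := leqP e (logn q d).
  have -> : i = e by apply/minn_idPl.
  rewrite -(@dvdn_pmul2l (q ^ e)) ?expn_gt0 ?q_gt0 // mulnC divnK //.
  by rewrite pfactor_dvdn.
have iE : i = logn q d by apply/minn_idPr/ltnW.
have dE : d = q ^ i * (d %/ q ^ i) by rewrite mulnC divnK.
have cop : coprime (d %/ q ^ i) (q ^ e).
  rewrite coprime_sym coprimeXl // prime_coprime // -[q]expn1 pfactor_dvdn //.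
    by rewrite logn_div // pfactorK // iE subnn.
  by rewrite divn_gt0 ?expn_gt0 ?q_gt0 // dvdn_leq.
rewrite -(Gauss_dvdr _ cop).
by apply: dvdn_trans d_dvd; rewrite {2}dE dvdn_mull.
Qed.

(** Take the [m]-th power of [e.+1 <= m * (e %/ m).+1 <= m * 2 ^ (e %/ m)]. It limits the loss at a
    small prime to the constant [m ^ m]. *)
Lemma succ_exp_le_exp2 m e : 0 < m -> e.+1 ^ m <= m ^ m * 2 ^ e.
Proof.
move=> m_gt0.
have h : e.+1 <= m * 2 ^ (e %/ m).
  apply: leq_trans (_ : m * (e %/ m).+1 <= _); first by rewrite mulnC ltn_ceil.
  by rewrite leq_mul2l ltn_expl // orbT.
rewrite -(leq_exp2r _ _ m_gt0) in h; apply: leq_trans h _.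
by rewrite expnMn -expnM leq_mul2l leq_exp2l // leq_divM orbT.
Qed.

(** Induction on [B], removing the largest admissible prime: its power [B ^ e] in [x] costs [e.+1 ^
    m <= m ^ m * 2 ^ e <= m ^ m * B ^ e]. *)
Lemma ndiv_exp_le_smooth m B : 0 < m -> exists C, 0 < C /\ forall x, 0 < x ->
  (forall q, prime q -> q %| x -> q < B) -> ndiv x ^ m <= C * x.
Proof.
move=> m_gt0; elim: B => [|B [C [C_gt0 IH]]].
  exists 1; split=> // x x_gt0 hx; have [x1|x_gt1] := leqP x 1.
    have -> : x = 1 by apply/eqP; rewrite eqn_leq x1.
    by rewrite /ndiv /= exp1n.
  by have := hx _ (pdiv_prime x_gt1) (pdiv_dvd x).
exists (m ^ m * C); split; first by rewrite muln_gt0 expn_gt0 m_gt0.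
move=> x x_gt0 hx.
have [B_pr|B_npr] := boolP (prime B); last first.
  apply: leq_trans (IH x x_gt0 _) _.
    move=> q q_pr q_x; have := hx q q_pr q_x; rewrite ltnS leq_eqVlt.
    by case/orP=> // /eqP qB; rewrite qB (negPf B_npr) in q_pr.
  by rewrite leq_mul2r leq_pmull ?expn_gt0 ?m_gt0 // orbT.
have [y cop xE] := pfactor_coprime B_pr x_gt0.
set e := logn B x in xE.
have y_gt0 : 0 < y by rewrite -(@ltn_pmul2r (B ^ e)) -?xE // expn_gt0 prime_gt0.
rewrite xE mulnC.
apply: leq_trans (_ : (e.+1 * ndiv y) ^ m <= _).
  by rewrite leq_exp2r // ndiv_pfactorM.
have hy : ndiv y ^ m <= C * y.
  apply: IH => // q q_pr q_y.
  have : q < B.+1 by apply: hx => //; rewrite xE dvdn_mulr.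
  rewrite ltnS leq_eqVlt => /orP[/eqP qB|//].
  by move: cop; rewrite prime_coprime // -qB q_y.
rewrite expnMn; apply: leq_trans (leq_mul (succ_exp_le_exp2 e m_gt0) hy) _.
rewrite [leqRHS](_ : _ = m ^ m * B ^ e * (C * y)); last by ring.
rewrite leq_mul2r leq_mul2l; apply/orP; right; apply/orP; right.
by case: (e) => [|?]; rewrite ?expn0 // leq_exp2r // prime_gt1.
Qed.

(** A prime [q >= 2 ^ m] costs nothing, since [e.+1 ^ m <= 2 ^ (e * m) <= q ^ e]; so the constant
    found for the primes below [2 ^ m] serves for all [x]. *)
Lemma ndiv_exp_le m : 0 < m -> exists C, 0 < C /\ forall x, 0 < x ->
  ndiv x ^ m <= C * x.
Proof.
move=> m_gt0; have [C [C_gt0 hC]] := ndiv_exp_le_smooth (2 ^ m) m_gt0.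
exists C; split=> //.
suff H B x : 0 < x -> (forall q, prime q -> q %| x -> q < 2 ^ m + B) ->
    ndiv x ^ m <= C * x.
  move=> x x_gt0; apply: (H x.+1) => // q _ q_x.
  by rewrite addnS ltnS (leq_trans (dvdn_leq _ q_x)) // leq_addl.
elim: B x => [|B IH] x x_gt0 hx.
  by apply: hC => // q q_pr q_x; rewrite -[2 ^ m]addn0 hx.
set Q := 2 ^ m + B; have hx' q : prime q -> q %| x -> q < Q.+1.
  by move=> *; rewrite /Q -addnS hx.
have [Q_pr|Q_npr] := boolP (prime Q); last first.
  apply: (IH x x_gt0) => q q_pr q_x.
  have := hx' q q_pr q_x; rewrite ltnS leq_eqVlt.
  by case/orP=> // /eqP qB; rewrite qB (negPf Q_npr) in q_pr.
have [y cop xE] := pfactor_coprime Q_pr x_gt0.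
set e := logn Q x in xE.
have y_gt0 : 0 < y by rewrite -(@ltn_pmul2r (Q ^ e)) -?xE // expn_gt0 prime_gt0.
rewrite xE mulnC.
apply: leq_trans (_ : (e.+1 * ndiv y) ^ m <= _).
  by rewrite leq_exp2r // ndiv_pfactorM.
have hy : ndiv y ^ m <= C * y.
  apply: IH => // q q_pr q_y.
  have : q < Q.+1 by apply: hx' => //; rewrite xE dvdn_mulr.
  rewrite ltnS leq_eqVlt => /orP[/eqP qB|//].
  by move: cop; rewrite prime_coprime // -qB q_y.
have he : e.+1 ^ m <= Q ^ e.
  apply: leq_trans (_ : (2 ^ e) ^ m <= _); first by rewrite leq_exp2r // ltn_expl.
  rewrite -expnM mulnC expnM; case: (e) => [|?]; first by rewrite !expn0.
  by rewrite leq_exp2r // /Q leq_addr.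
rewrite expnMn; apply: leq_trans (leq_mul he hy) _.
by rewrite mulnCA.
Qed.

(** The exponent [m * M] followed by an [M]-th root. Integers polynomially bounded in [P] thus have
    fewer divisors than any fixed power of [P], up to a constant. *)
Lemma ndiv_exp_le_root m M : 0 < m -> 0 < M ->
  exists C, 0 < C /\ forall P x, 0 < x -> x <= P ^ M -> ndiv x ^ m <= C * P.
Proof.
move=> m_gt0 M_gt0.
have [|C [C_gt0 hC]] := @ndiv_exp_le (m * M); first by rewrite muln_gt0 m_gt0.
exists C; split=> // P x x_gt0 x_le.
rewrite -(leq_exp2r _ _ M_gt0) -expnM; apply: leq_trans (hC x x_gt0) _.
rewrite expnMn leq_mul //.
by rewrite -[leqLHS]expn1 leq_pexp2l.
Qed.

End DivisorBound.

(** * Chebyshev and Mertens estimates, smooth numbers *)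

Section Primorial.
Local Open Scope nat_scope.

Lemma prod_primes_dvdn (s : seq nat) x : uniq s ->
  (forall q, q \in s -> prime q /\ q %| x) -> \prod_(q <- s) q %| x.
Proof.
elim: s => [|q s IH]; first by rewrite big_nil dvd1n.
rewrite cons_uniq => /andP[q_s s_uniq] hs; rewrite big_cons.
have [q_pr q_x] := hs q (mem_head _ _).
have hs' r : r \in s -> prime r /\ r %| x.
  by move=> r_s; apply: hs; rewrite inE r_s orbT.
rewrite Gauss_dvd ?q_x ?IH //.
rewrite big_seq; apply: (big_ind (fun y => coprime q y)) => [|y z|];
  rewrite ?coprimen1 //.
  by move=> cy cz; rewrite coprimeMr cy.
move=> r r_s; have [r_pr _] := hs' r r_s.
rewrite prime_coprime // dvdn_prime2 //.
by apply: contraNneq q_s => ->.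
Qed.

(** This coefficient occurs twice in the expansion of [(1 + 1) ^ m.*2.+1]. *)
Lemma central_bin_le m : 'C(m.*2.+1, m) <= 4 ^ m.
Proof.
have h : 'C(m.*2.+1, m) + 'C(m.*2.+1, m.+1) <= 2 ^ m.*2.+1.
  rewrite -[2]/(1 + 1) expnDn.
  have hm : m < m.*2.+2 by lia.
  have hm1 : m.+1 < m.*2.+2 by lia.
  rewrite (bigD1 (Ordinal hm)) //= (bigD1 (Ordinal hm1)) /=; last first.
    by rewrite -val_eqE /=; lia.
  by rewrite !exp1n !muln1 addnA leq_addr.
have e : 'C(m.*2.+1, m.+1) = 'C(m.*2.+1, m).
  by rewrite -bin_sub; [congr (binomial _ _); lia | lia].
rewrite e addnn expnS -mul2n leq_pmul2l // in h.
by rewrite (_ : 4 = 2 ^ 2) // -expnM mul2n.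
Qed.

(** Erdos's argument: for [n = 2m + 1] the primes in [(m + 1, 2m + 1]] all divide ['C(2m + 1, m)],
    and an even [n > 2] adds no prime to [n - 1]. *)
Lemma primorial_le n : \prod_(1 <= q < n.+1 | prime q) q <= 4 ^ n.
Proof.
elim/ltn_ind: n => n IH.
have [n_le2|n_gt2] := leqP n 2.
  by case: n n_le2 {IH} => [|[|[|//]]] _; rewrite unlock.
have [n_odd|n_even] := boolP (odd n); last first.
  case: n IH n_gt2 n_even => // n IH n_gt2 n_even.
  have n_npr : ~~ prime n.+1.
    by apply: contraNN n_even => /even_prime[n2|//]; rewrite n2 in n_gt2.
  rewrite big_mkcond big_nat_recr //= (negPf n_npr) muln1 -big_mkcond.
  by apply: leq_trans (IH n _) _; rewrite // leq_exp2l.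
set m := n./2.
have nE : n = m.*2.+1 by rewrite -[LHS]odd_double_half n_odd.
rewrite nE (@big_cat_nat _ _ _ m.+2) /=; [|lia|lia].
have -> : 4 ^ m.*2.+1 = 4 ^ m.+1 * 4 ^ m by rewrite -expnD; congr (4 ^ _); lia.
apply: leq_mul; first by apply: IH; lia.
apply: leq_trans (central_bin_le m).
apply: dvdn_leq; first by rewrite bin_gt0; lia.
rewrite -big_filter; apply: prod_primes_dvdn.
  by rewrite filter_uniq // iota_uniq.
move=> q; rewrite mem_filter mem_index_iota => /andP[q_pr /andP[q_gt q_lt]].
split=> //.
have : q %| (m.*2.+1)`! by rewrite dvdn_fact // prime_gt0.
have m_le : m <= m.*2.+1 by lia.
have nfact k : k < q -> ~~ (q %| k`!).
  move=> kq; apply/negP; rewrite fact_prod (Euclid_dvd_prod _ _ _ q_pr) big_has.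
  move=> /hasP[j]; rewrite mem_index_iota => /andP[j_gt0 j_k].
  by move/(dvdn_leq j_gt0); lia.
rewrite -(bin_fact m_le) !Euclid_dvdM // => /orP[//|/orP[]].
  by rewrite (negPf (nfact _ _)) //; lia.
by rewrite (negPf (nfact _ _)) //; lia.
Qed.

(** With Legendre's formula this bounds the exponent of [q] in the factorial of [n] by
    [n / (q - 1)]. The term [n %/ q ^ m] carries the induction. *)
Lemma geometric_divn_le q n m :
  0 < q -> q.-1 * \sum_(1 <= k < m.+1) n %/ q ^ k + n %/ q ^ m <= n.
Proof.
move=> q_gt0; elim: m => [|m IH].
  by rewrite big_geq // muln0 expn0 divn1.
rewrite big_nat_recr //= mulnDr -addnA; apply: leq_trans IH.
rewrite leq_add2l; set d := n %/ q ^ m.+1.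
have -> : q.-1 * d + d = q * d by rewrite -mulSnr prednK.
by rewrite /d expnSr divnMA mulnC leq_divM.
Qed.

Lemma prod_pfactor_le x n : 0 < x -> (forall q, prime q -> q %| x -> q <= n) ->
  x = \prod_(1 <= q < n.+1 | prime q) q ^ logn q x.
Proof.
move=> x_gt0 hx.
rewrite -{1}(partnT x_gt0) (@widen_partn (maxn x n)) ?leq_maxl //.
rewrite big_ltn_cond //= lognE /= mul1n.
have hn : n.+1 <= (maxn x n).+1 by rewrite ltnS leq_maxr.
rewrite (@big_cat_nat _ _ _ n.+1) //= [X in _ * X]big_nat_cond [X in _ * X]big1 ?muln1.
  rewrite big_mkcond [RHS]big_mkcond; apply: eq_bigr => q _ /=.
  by rewrite lognE; case: (prime q).
move=> q /andP[/andP[n_q _] _]; rewrite lognE.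
by case: and3P => // -[q_pr _ /(hx q q_pr)]; rewrite leqNgt n_q.
Qed.

End Primorial.

Section Mertens.
Variable R : realType.
Implicit Types (n q x y : nat).

Local Notation lnn n := (@ln R n%:R).

Lemma lnn_ge0 n : 0 <= lnn n.
Proof.
case: n => [|n]; first by rewrite ln0.
by rewrite ln_ge0 // ler1n.
Qed.

Lemma lnnM x y : (0 < x)%N -> (0 < y)%N -> lnn (x * y) = lnn x + lnn y.
Proof. by move=> x0 y0; rewrite natrM lnM // posrE ltr0n. Qed.

Lemma lnn_exp x k : (0 < x)%N -> lnn (x ^ k) = k%:R * lnn x.
Proof. by move=> x0; rewrite natrX lnXn ?ltr0n // mulr_natl. Qed.

Lemma lnn_le x y : (0 < x)%N -> (x <= y)%N -> lnn x <= lnn y.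
Proof.
move=> x0 xy; rewrite ler_ln ?posrE ?ltr0n ?ler_nat //; exact: leq_trans xy.
Qed.

Lemma lnn_prod (s : seq nat) (Q : pred nat) (F : nat -> nat) :
  (forall q, Q q -> 0 < F q)%N ->
  lnn (\prod_(q <- s | Q q) F q) = \sum_(q <- s | Q q) lnn (F q).
Proof.
move=> hF.
suff : (0 < \prod_(q <- s | Q q) F q)%N /\
  lnn (\prod_(q <- s | Q q) F q) = \sum_(q <- s | Q q) lnn (F q) by case.
elim/big_rec2: _ => [|q y1 y2 Qq [y2_gt0 <-]]; first by rewrite ln1.
by rewrite muln_gt0 hF // y2_gt0 lnnM // hF.
Qed.

Lemma lnn_step n : (0 < n)%N -> lnn n.+1 - lnn n <= n%:R^-1.
Proof.
move=> n0; have n0R : 0 < n%:R :> R by rewrite ltr0n.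
rewrite -ln_div ?posrE ?ltr0n //.
have -> : n.+1%:R / n%:R = 1 + n%:R^-1 :> R.
  by rewrite -natr1 mulrDl divff ?lt0r_neq0 // mul1r.
apply: le_ln1Dx; apply: lt_trans (_ : 0 < _); first by rewrite ltrN10.
by rewrite invr_gt0.
Qed.

Lemma lnn_step_ge n : (0 < n)%N -> n.+1%:R^-1 <= lnn n.+1 - lnn n.
Proof.
move=> n0; have n0R : 0 < n%:R :> R by rewrite ltr0n.
have n1R : 0 < n.+1%:R :> R by rewrite ltr0n.
rewrite -opprB lerNr -ln_div ?posrE //.
have -> : n%:R / n.+1%:R = 1 + - n.+1%:R^-1 :> R.
  rewrite -[n%:R](addrK 1) natr1 mulrDl divff ?lt0r_neq0 //.
  by rewrite mulNr mul1r.
apply: le_ln1Dx; rewrite ltrN2 invf_lt1 // ltr1n ltnS //.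
Qed.

Lemma ln_fact_ge n : n%:R * lnn n - n%:R <= lnn n`!.
Proof.
elim: n => [|n IH]; first by rewrite mul0r subr0 fact0 ln1.
rewrite factS lnnM ?fact_gt0 //; apply: le_trans (lerD (lexx _) IH).
case: n {IH} => [|n]; first by rewrite mul1r mul0r subr0 ln1 addr0 lerBlDr add0r ler01.
have := lnn_step (ltn0Sn n).
rewrite -(ler_pM2l (_ : 0 < n.+1%:R :> R)) ?ltr0n // divff ?pnatr_eq0 //.
rewrite -[n.+2%:R]natr1; lra.
Qed.

Lemma ln_fact_primes n : lnn n`! =
  \sum_(1 <= q < n.+1 | prime q) (logn q n`!)%:R * lnn q.
Proof.
rewrite [in LHS](@prod_pfactor_le n`! n) ?fact_gt0 //; last first.
  move=> q q_pr; rewrite fact_prod (Euclid_dvd_prod _ _ _ q_pr) big_has.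
  move=> /hasP[j]; rewrite mem_index_iota => /andP[j_gt0 j_n].
  by move/(dvdn_leq j_gt0) => /leq_trans; apply; rewrite -ltnS.
rewrite lnn_prod => [|q q_pr]; last by rewrite expn_gt0 prime_gt0.
by apply: eq_bigr => q q_pr; rewrite lnn_exp ?prime_gt0.
Qed.

Definition mertens_sum n : R := \sum_(1 <= q < n.+1 | prime q) lnn q / q%:R.

(** The exponent of [q] in the factorial of [n] is at least [n / q - 1]. The loss of 1 at each prime
    amounts to the logarithm of the primorial, hence to at most [n ln 4]. *)
Lemma mertens_sum_le n : (0 < n)%N -> mertens_sum n <= lnn n + lnn 4.
Proof.
move=> n0; have n0R : 0 < n%:R :> R by rewrite ltr0n.
have h1 : lnn n`! <= n%:R * lnn n.
  rewrite -lnn_exp //; apply: lnn_le; first exact: fact_gt0.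
  have -> : (n ^ n = \prod_(1 <= i < n.+1) n)%N.
    by rewrite prod_nat_const_nat subn1.
  rewrite fact_prod.
  rewrite big_nat_cond [leqRHS]big_nat_cond.
  by apply: leq_prod => i; rewrite andbT ltnS => /andP[].
have h2 : \sum_(1 <= q < n.+1 | prime q) lnn q <= n%:R * lnn 4.
  rewrite -lnn_exp // -lnn_prod => [|q /prime_gt0//].
  apply: lnn_le; last exact: primorial_le.
  by rewrite prodn_cond_gt0 // => q /prime_gt0.
have h3 : n%:R * mertens_sum n <=
    lnn n`! + \sum_(1 <= q < n.+1 | prime q) lnn q.
  rewrite ln_fact_primes -big_split /= mulr_sumr.
  apply: ler_sum => q q_pr; have q0 := prime_gt0 q_pr.
  rewrite -[X in _ + X]mul1r -mulrDl mulrCA mulrC ler_wpM2r ?lnn_ge0 //.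
  rewrite ler_pdivrMr ?ltr0n // natr1 -natrM ler_nat.
  apply: leq_trans (ltnW (ltn_ceil n q0)) _; rewrite leq_pmul2r // ltnS.
  by rewrite logn_fact // big_ltn // expn1 leq_addr.
rewrite -(ler_pM2l n0R) mulrDr; lra.
Qed.

Lemma sum_ln_over_pronic_le n :
  \sum_(2 <= i < n.+1) lnn i / (i%:R * i.-1%:R) <= 2.
Proof.
(* [g] is chosen so that [g i.-1 - g i] dominates the summand; the sum then telescopes to at most
   [g 1 = 2]. *)
pose g i : R := (lnn i + 2) / i%:R.
have g_ge0 i : 0 <= g i by rewrite divr_ge0 // addr_ge0 ?lnn_ge0.
have [n_le|n_gt] := leqP n 1; first by rewrite big_geq // ltnS.
have step i : (2 <= i)%N -> lnn i / (i%:R * i.-1%:R) <= g i.-1 - g i.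
  case: i => [|[|i]] // _; rewrite /g /=.
  have i1 : 0 < i.+1%:R :> R by rewrite ltr0n.
  have i2 : 0 < i.+2%:R :> R by rewrite ltr0n.
  have -> : (lnn i.+1 + 2) / i.+1%:R - (lnn i.+2 + 2) / i.+2%:R =
     (lnn i.+2 + (2 - i.+2%:R * (lnn i.+2 - lnn i.+1))) / (i.+2%:R * i.+1%:R).
    have e : i.+2%:R = i.+1%:R + 1 :> R by rewrite natr1.
    rewrite e in i2 *; field; rewrite !lt0r_neq0 //.
  rewrite ler_pM2r ?invr_gt0 ?mulr_gt0 // lerDl subr_ge0.
  apply: le_trans (_ : i.+2%:R * i.+1%:R^-1 <= _).
    by rewrite ler_pM2l // lnn_step.
  by rewrite ler_pdivrMr // -natrM ler_nat; lia.
apply: le_trans (_ : \sum_(2 <= i < n.+1) (g i.-1 - g i) <= _).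
  by apply: ler_sum_nat => i /andP[i2 _]; exact: step.
have -> : \sum_(2 <= i < n.+1) (g i.-1 - g i) = - g n - - g 1%N.
  apply: (@telescope_sumr_eq _ _ _ (fun i => - g i.-1)); first exact: ltnW.
  by move=> i _ /=; rewrite opprK addrC.
by rewrite opprK [g 1%N]/g ln1 add0r divr1 gerDr oppr_le0.
Qed.

(** The exponent of [q] in the factorial is at most [n / (q - 1)], and
    [1 / (q - 1) = 1 / q + 1 / (q (q - 1))]. The second part costs 2 in all, and Stirling's lower
    bound [ln_fact_ge] costs 1. *)
Lemma mertens_sum_ge n : (0 < n)%N -> lnn n - 3 <= mertens_sum n.
Proof.
move=> n0; have n0R : 0 < n%:R :> R by rewrite ltr0n.
have h1 := ln_fact_ge n.
have h2 : lnn n`! <= \sum_(1 <= q < n.+1 | prime q) n%:R / q.-1%:R * lnn q.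
  rewrite ln_fact_primes; apply: ler_sum => q q_pr.
  have q1 : (0 < q.-1)%N by have := prime_gt1 q_pr; lia.
  rewrite ler_wpM2r ?lnn_ge0 // ler_pdivlMr ?ltr0n // -natrM ler_nat.
  rewrite logn_fact // mulnC.
  by apply: leq_trans (geometric_divn_le n n (prime_gt0 q_pr)); apply: leq_addr.
have h3 : \sum_(1 <= q < n.+1 | prime q) n%:R / q.-1%:R * lnn q =
    n%:R * mertens_sum n +
    n%:R * \sum_(1 <= q < n.+1 | prime q) lnn q / (q%:R * q.-1%:R).
  rewrite -mulrDr -big_split /= mulr_sumr; apply: eq_bigr => q q_pr.
  have q1 : 0 < q.-1%:R :> R by have := prime_gt1 q_pr; rewrite ltr0n; lia.
  have e : q%:R = q.-1%:R + 1 :> R by rewrite natr1 prednK // prime_gt0.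
  rewrite e; field; rewrite lt0r_neq0 // lt0r_neq0 //; lra.
have h4 : \sum_(1 <= q < n.+1 | prime q) lnn q / (q%:R * q.-1%:R) <= 2.
  apply: le_trans (sum_ln_over_pronic_le n).
  rewrite big_ltn_cond //= big_mkcond; apply: ler_sum => q _.
  by case: ifP => // _; rewrite divr_ge0 ?lnn_ge0 // mulr_ge0.
have : n%:R * (lnn n - 3) <= n%:R * mertens_sum n.
  rewrite -(ler_pM2l n0R) in h4; lra.
by rewrite ler_pM2l.
Qed.

(** Cutting at powers of [P] replaces partial summation: on this piece [ln q >= i ln P], and the two
    Mertens bounds differ by [ln P + ln 4 + 3]. *)
Lemma sum_inv_primes_piece P i : (1 < P)%N -> (0 < i)%N ->
  \sum_((P ^ i).+1 <= q < (P ^ i.+1).+1 | prime q) q%:R^-1 <=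
  i%:R^-1 + (lnn 4 + 3) / lnn P.
Proof.
move=> P1 i0; have P0 : (0 < P)%N by lia.
have lnP : 0 < lnn P by rewrite ln_gt0 // ltr1n.
have i0R : 0 < i%:R :> R by rewrite ltr0n.
have PiP : (P ^ i <= P ^ i.+1)%N by rewrite leq_exp2l.
have h : \sum_((P ^ i).+1 <= q < (P ^ i.+1).+1 | prime q) lnn q / q%:R <=
    lnn P + (lnn 4 + 3).
  have e : mertens_sum (P ^ i.+1) = mertens_sum (P ^ i) +
      \sum_((P ^ i).+1 <= q < (P ^ i.+1).+1 | prime q) lnn q / q%:R.
    by rewrite /mertens_sum (@big_cat_nat _ _ _ (P ^ i).+1).
  have u := @mertens_sum_le (P ^ i.+1) (ltac:(by rewrite expn_gt0 P0)).
  have l := @mertens_sum_ge (P ^ i) (ltac:(by rewrite expn_gt0 P0)).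
  rewrite e in u; rewrite !lnn_exp // -natr1 in u l; lra.
have ilnP : 0 < i%:R * lnn P by rewrite mulr_gt0.
apply: le_trans (_ : (lnn P + (lnn 4 + 3)) / (i%:R * lnn P) <= _).
  rewrite ler_pdivlMr // mulr_suml; apply: le_trans h.
  rewrite big_nat_cond [leRHS]big_nat_cond.
  apply: ler_sum => q /andP[/andP[q_gt _] q_pr].
  rewrite mulrC ler_pM2r ?invr_gt0 ?ltr0n ?prime_gt0 //.
  rewrite -lnn_exp //; apply: lnn_le; first by rewrite expn_gt0 P0.
  exact: ltnW.
rewrite mulrDl lerD //.
  by rewrite invfM mulrCA divff ?mulr1 // lt0r_neq0.
have c0 : 0 < lnn 4 + 3 by have := lnn_ge0 4; lra.
rewrite ler_pM2l //.
by rewrite lef_pV2 ?posrE //; apply: ler_peMl; [exact: ltW | rewrite ler1n].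
Qed.

(** The pieces contribute [1 / i] for [b <= i < a], and [1 / i <= ln i - ln (i - 1)] telescopes. *)
Lemma sum_inv_primes_le P a b : (1 < P)%N -> (1 < b <= a)%N ->
  \sum_((P ^ b).+1 <= q < (P ^ a).+1 | prime q) q%:R^-1 <=
  lnn a.-1 - lnn b.-1 + (a - b)%:R * ((lnn 4 + 3) / lnn P).
Proof.
move=> P1 /andP[b1 /subnKC <-]; elim: (a - b)%N => [|d IH].
  by rewrite addn0 big_geq // !subrr subnn mul0r add0r.
rewrite addKn in IH; rewrite addKn.
rewrite (@big_cat_nat _ _ _ (P ^ (b + d)).+1) /=; last 2 first.
- by rewrite ltnS leq_exp2l // leq_addr.
- by rewrite ltnS leq_exp2l // addnS.
rewrite addnS; have bd0 : (0 < b + d)%N by lia.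
apply: le_trans (lerD IH (sum_inv_primes_piece P1 bd0)) _.
have := @lnn_step_ge (b + d).-1; rewrite prednK // => h.
have := h (ltac:(lia)); rewrite /= -[d.+1%:R]natr1; lra.
Qed.

Definition smooth (U n : nat) : bool := all (fun q => q <= U)%N (primes n).

Lemma smoothP (U n : nat) : (0 < n)%N ->
  reflect (forall q, prime q -> (q %| n)%N -> (q <= U)%N) (smooth U n).
Proof.
move=> n0; apply: (iffP allP) => h q.
  by move=> q_pr q_n; apply: h; rewrite mem_primes q_pr n0.
by rewrite mem_primes => /and3P[q_pr _ q_n]; apply: h.
Qed.

(** Union bound over a prime factor [q > U], which has at most [N / q] multiples in the range. *)
Lemma card_nonsmooth_le U N :
  #|[set i : 'I_N | ~~ smooth U i.+1]|%:R <=
  N%:R * \sum_(U.+1 <= q < N.+1 | prime q) q%:R^-1 :> R.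
Proof.
have h : (#|[set i : 'I_N | ~~ smooth U i.+1]| <=
    \sum_(U.+1 <= q < N.+1 | prime q) #|[set i : 'I_N | q %| i.+1]|)%N.
  apply: leq_trans (_ : \sum_(i : 'I_N)
      \sum_(U.+1 <= q < N.+1 | prime q) (q %| i.+1)%N <= _)%N.
    rewrite -sum1dep_card big_mkcond /=; apply: leq_sum => i _.
    case: ifP => // /allPn[q]; rewrite mem_primes => /and3P[q_pr _ q_i].
    rewrite -ltnNge => q_U.
    have q_N : (q < N.+1)%N by rewrite ltnS (leq_trans (dvdn_leq _ q_i)).
    rewrite big_mkcond (bigD1_seq q) /= ?q_pr ?q_i ?iota_uniq //.
    by rewrite mem_index_iota q_U q_N.
  rewrite exchange_big /=; apply: leq_sum => q _.
  by rewrite -sum1dep_card [leqRHS]big_mkcond; apply: leq_sum => i _; case: (q %| _)%N.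
rewrite -(ler_nat R) in h; apply: le_trans h _.
rewrite natr_sum mulr_sumr; apply: ler_sum => q q_pr.
have q0 := prime_gt0 q_pr.
rewrite ler_pdivlMr ?ltr0n // -natrM ler_nat.
apply: leq_trans (_ : (N %/ q) * q <= _)%N; last exact: leq_divM.
rewrite leq_mul2r; apply/orP; right.
pose f (i : 'I_N) : nat := (i.+1 %/ q)%N.
have : (#|[set i : 'I_N | (q %| i.+1)%N]| <= size (iota 1 (N %/ q)))%N.
  rewrite cardE -(size_map f); apply: uniq_leq_size.
    rewrite map_inj_in_uniq ?enum_uniq // => i j.
    rewrite !mem_enum !inE => qi qj; rewrite /f => e.
    apply/val_inj/succn_inj; rewrite -(divnK qi) -(divnK qj) e //.
  move=> x /mapP[j]; rewrite mem_enum inE => qj ->.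
  rewrite mem_iota add1n ltnS leq_div2r // andbT divn_gt0 //.
  exact: dvdn_leq.
by rewrite size_iota.
Qed.

(* Mertens: the proportion of [P^b]-smooth numbers up to [P^a] tends to
   [1 - ln (a / b)] when [a <= 2 b]. *)
Lemma smooth_majority a b : (1 < b <= a)%N -> lnn a.-1 - lnn b.-1 < 2^-1 ->
  exists2 c : R, 0 < c & exists P0 : nat, forall P : nat, (P0 <= P)%N ->
    (2^-1 + c) * (P ^ a)%:R <= #|[set i : 'I_(P ^ a) | smooth (P ^ b) i.+1]|%:R.
Proof.
move=> /[dup] hab /andP[b1 ba] hln.
(* Half of the available gap; the other half absorbs the error term in [1 / ln P]. *)
pose c : R := (2^-1 - (lnn a.-1 - lnn b.-1)) / 2.
have c0 : 0 < c by rewrite /c; lra.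
exists c => //.
(* Once [ln P >= t], the error [(a - b) (ln 4 + 3) / ln P] is at most [c]. *)
pose t : R := (a - b)%:R * (lnn 4 + 3) / c.
exists (maxn 2 (Num.truncn (expR t)).+1) => P; rewrite geq_max => /andP[P1 Pt].
have P0 : (0 < P)%N by lia.
have lnP : 0 < lnn P by rewrite ln_gt0 // ltr1n.
have tP : t <= lnn P.
  rewrite -ler_expR lnK ?posrE ?ltr0n //; apply: le_trans (ltW (truncnS_gt _)) _.
  by rewrite ler_nat.
set A := [set i | smooth _ _].
have e : #|A|%:R = (P ^ a)%:R - #|[set i : 'I_(P ^ a) | ~~ smooth (P ^ b) i.+1]|%:R :> R.
  have := cardsC A; rewrite card_ord => /(congr1 (fun n => n%:R : R)).
  rewrite natrD => <-; rewrite -[RHS]addrA; apply/eqP.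
  rewrite -subr_eq0 opprD addNKr ?addrA; apply/eqP.
  have -> : ~: A = [set i : 'I_(P ^ a) | ~~ smooth (P ^ b) i.+1].
    by apply/setP => i; rewrite !inE.
  lra.
have h1 := card_nonsmooth_le (P ^ b) (P ^ a).
have h2 := sum_inv_primes_le P1 hab.
have h3 : (a - b)%:R * ((lnn 4 + 3) / lnn P) <= c.
  rewrite mulrA ler_pdivrMr // [c * _]mulrC -ler_pdivrMr //.
have h4 : #|[set i : 'I_(P ^ a) | ~~ smooth (P ^ b) i.+1]|%:R <=
    (P ^ a)%:R * (2^-1 - c).
  apply: le_trans h1 _; rewrite ler_wpM2l //.
  apply: le_trans h2 _.
  have : 2 * c = 2^-1 - (lnn a.-1 - lnn b.-1) by rewrite /c; field.
  lra.
rewrite e; lra.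
Qed.

End Mertens.

(** * Packing into bins *)

Section Packing.
Local Open Scope nat_scope.

(** One of the products [w * u1] and [u2 * u3] is at most [U], as otherwise the whole would exceed
    [U ^ 2]; merge that pair. *)
Lemma three_bins_add U w u1 u2 u3 :
  w <= U -> u1 <= U -> u2 <= U -> u3 <= U -> w * u1 * u2 * u3 <= U ^ 2 ->
  exists v1 v2 v3, [/\ v1 <= U, v2 <= U, v3 <= U
    & v1 * v2 * v3 = w * u1 * u2 * u3].
Proof.
move=> hw h1 h2 h3 hU.
have [?|g1] := leqP (w * u1) U; first by exists (w * u1), u2, u3; split.
have [?|g2] := leqP (u2 * u3) U.
  by exists w, u1, (u2 * u3); split=> //; rewrite !mulnA.
have : U.+1 * U.+1 <= w * u1 * (u2 * u3) by exact: leq_mul.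
by rewrite mulnA => /leq_trans/(_ hU); rewrite -mulnn leqNgt ltn_mul.
Qed.

(** The prime factors of [n] are put one at a time into three bins, [three_bins_add] restoring the
    number of bins. *)
Lemma smooth_three_factors U n : 0 < U -> 0 < n -> n <= U ^ 2 ->
  (forall q, prime q -> q %| n -> q <= U) ->
  exists u1 u2 u3, [/\ u1 <= U, u2 <= U, u3 <= U & u1 * u2 * u3 = n].
Proof.
move=> U_gt0; elim/ltn_ind: n => n IH n_gt0 n_le hn.
have [n1|n_gt1] := leqP n 1.
  exists 1, 1, 1; split=> //.
  by apply/eqP; rewrite eqn_leq n_gt0 n1.
set q := pdiv n; have q_pr : prime q := pdiv_prime n_gt1.
have q_n : q %| n := pdiv_dvd n.
set m := n %/ q; have nE : n = q * m by rewrite mulnC divnK.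
have m_gt0 : 0 < m by rewrite divn_gt0 ?prime_gt0 // dvdn_leq.
have m_n : m %| n by rewrite nE dvdn_mull.
have m_lt : m < n by rewrite ltn_Pdiv // prime_gt1.
have [||u1 [u2 [u3 [h1 h2 h3 mE]]]] := IH m m_lt m_gt0.
- by apply: leq_trans n_le; apply: ltnW.
- by move=> r r_pr r_m; apply: hn => //; apply: dvdn_trans m_n.
have [||||| v1 [v2 [v3 [k1 k2 k3 vE]]]] := @three_bins_add U q u1 u2 u3 => //.
- exact: hn.
- by rewrite -!mulnA [u1 * _]mulnA mE -nE.
by exists v1, v2, v3; split=> //; rewrite vE nE -mE !mulnA.
Qed.

(** Some bin has room for a factor [P]: if every [u i * P] exceeded [U], the product of all of them
    would exceed [U ^ s]. *)
Lemma bins_add (s : nat) (u : 'I_s -> nat) U P v :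
  v <= P -> 0 < U -> (forall i, u i <= U) ->
  (\prod_i u i) * P ^ s <= U ^ s -> 0 < s ->
  exists u' : 'I_s -> nat, (forall i, u' i <= U) /\
    \prod_i u' i = (\prod_i u i) * v.
Proof.
move=> vP U_gt0 hu hprod s_gt0.
have [i hi] : exists i, u i * P <= U.
  apply/existsP; rewrite -[[exists _, _]]negbK negb_exists; apply/forallP => h.
  have : \prod_(i < s) U.+1 <= \prod_(i < s) (u i * P).
    by apply: leq_prod => i _; rewrite ltnNge h.
  rewrite big_split /= !prod_nat_const card_ord => /leq_trans/(_ hprod).
  by rewrite leq_exp2r // ltnn.
exists (fun j => if j == i then u i * v else u j); split.
  move=> j; case: eqP => [_|//]; apply: leq_trans hi; exact: leq_mul.
rewrite (bigD1 i) //= eqxx [in RHS](bigD1 i) //= -!mulnA; congr (_ * _).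
rewrite mulnC; congr (_ * _); apply: eq_bigr => j /negPf ->//.
Qed.

Lemma bins_add_many (s k : nat) (v : 'I_k -> nat) (u : 'I_s -> nat) U P :
  0 < P -> (forall i, v i <= P) -> 0 < U -> (forall i, u i <= U) ->
  (\prod_i u i) * P ^ k * P ^ s <= U ^ s -> 0 < s ->
  exists u' : 'I_s -> nat, (forall i, u' i <= U) /\
    \prod_i u' i = (\prod_i u i) * \prod_i v i.
Proof.
move=> P_gt0 + U_gt0; elim: k v u => [|k IH] v u hv hu hprod s_gt0.
  by exists u; split=> //; rewrite big_ord0 muln1.
have [|u' [hu' u'E]] := @bins_add s u U P (v ord0) (hv _) U_gt0 hu _ s_gt0.
  apply: leq_trans hprod; rewrite leq_mul2r; apply/orP; right.
  by rewrite leq_pmulr // expn_gt0 P_gt0.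
have [||u2 [hu2 u2E]] := IH (fun i => v (lift ord0 i)) u' _ hu' _ s_gt0.
- by move=> i; apply: hv.
- apply: leq_trans hprod; rewrite u'E leq_mul2r; apply/orP; right.
  by rewrite -mulnA leq_mul2l expnS leq_mul2r hv !orbT.
by exists u2; split=> //; rewrite u2E u'E big_ord_recl mulnA.
Qed.

(** Each [ni] fills three bins and the seventh starts at 1. In [P ^ (k + 7)], [P ^ k] bounds the
    product of the [v i] and [P ^ 7] is the slack of one factor [P] per bin that [bins_add] asks
    for. *)
Lemma seven_factors U P k (v : 'I_k -> nat) n1 n2 N :
  0 < P -> 0 < U -> N <= U ^ 2 -> (forall i, v i <= P) ->
  0 < n1 <= N -> 0 < n2 <= N ->
  (forall q, prime q -> q %| n1 -> q <= U) ->
  (forall q, prime q -> q %| n2 -> q <= U) ->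
  N ^ 2 * P ^ (k + 7) <= U ^ 7 ->
  exists u : 'I_7 -> nat, (forall i, u i <= U) /\
    \prod_i u i = n1 * n2 * \prod_i v i.
Proof.
move=> P_gt0 U_gt0 hN hv /andP[n1_gt0 n1N] /andP[n2_gt0 n2N] s1 s2 hU.
have [a1 [a2 [a3 [ha1 ha2 ha3 aE]]]] :=
  smooth_three_factors U_gt0 n1_gt0 (leq_trans n1N hN) s1.
have [b1 [b2 [b3 [hb1 hb2 hb3 bE]]]] :=
  smooth_three_factors U_gt0 n2_gt0 (leq_trans n2N hN) s2.
pose s := [:: a1; a2; a3; b1; b2; b3; 1].
pose u (i : 'I_7) := nth 0 s i.
have uE : \prod_i u i = n1 * n2.
  by rewrite !big_ord_recl big_ord0 /u /= -aE -bE; ring.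
have hu i : u i <= U.
  have : all (fun x => x <= U) s.
    by rewrite /= ha1 ha2 ha3 hb1 hb2 hb3 U_gt0.
  by move/allP; apply; apply: mem_nth.
have [//|u' [hu' u'E]] := bins_add_many P_gt0 hv U_gt0 hu _ (isT : 0 < 7).
  rewrite uE -mulnA -expnD; apply: leq_trans hU.
  by rewrite leq_mul2r -mulnn leq_mul ?orbT.
by exists u'; split=> //; rewrite u'E uE.
Qed.

End Packing.

(** * Fermat quotients *)

Section FermatQuotient.
Variables (p : nat) (p_pr : prime p).
Implicit Types (m n y z w t : nat).

Let p_gt0 : (0 < p)%N := prime_gt0 p_pr.

Definition fq n : 'F_p := ((n ^ p.-1 - 1) %/ p)%:R.

Lemma Fp_eq_mod m n : (m%:R = n%:R :> 'F_p) <-> (m = n %[mod p])%N.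
Proof.
split=> h; last by rewrite -(Fp_nat_mod p_pr m) h Fp_nat_mod.
by rewrite -!(val_Fp_nat p_pr) h.
Qed.

Lemma Fp_nat_eq0 n : ((n%:R : 'F_p) == 0) = (p %| n)%N.
Proof.
by apply/eqP/idP => [/(Fp_eq_mod n 0)|h]; rewrite /dvdn; [move=> ->; rewrite mod0n|
  apply/(Fp_eq_mod n 0); rewrite mod0n; apply/eqP].
Qed.

Lemma coprime_neq0 n : coprime n p -> (n%:R : 'F_p) != 0.
Proof. by rewrite Fp_nat_eq0 coprime_sym prime_coprime. Qed.

Lemma lt_coprime n : (0 < n < p)%N -> coprime n p.
Proof.
by move=> /andP[n0 np]; rewrite coprime_sym prime_coprime // gtnNdvd.
Qed.

Lemma fermat_exp n : coprime n p ->
  (n ^ p.-1 = 1 + p * ((n ^ p.-1 - 1) %/ p))%N.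
Proof.
move=> cop; have h : (n ^ p.-1 = 1 %[mod p])%N.
  apply/Fp_eq_mod; have n0 := coprime_neq0 cop; apply: (mulfI n0).
  rewrite -natrM -expnS prednK // mulr1.
  by apply/Fp_eq_mod; exact: fermat_little.
have n_gt0 : (0 < n)%N.
  case: n cop {h} => //; rewrite /coprime gcd0n => /eqP p1.
  by have := prime_gt1 p_pr; rewrite p1.
have pn : (p %| n ^ p.-1 - 1)%N.
  by rewrite -eqn_mod_dvd ?expn_gt0 ?n_gt0 //; apply/eqP.
by rewrite mulnC divnK // subnKC // expn_gt0 n_gt0.
Qed.

Lemma fq_eq n t : coprime n p -> (n ^ p.-1 = 1 + p * t %[mod p ^ 2])%N ->
  fq n = t%:R.
Proof.
move=> cop; rewrite (fermat_exp cop) => /eqP.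
rewrite eqn_modDl -mulnn -!muln_modr eqn_pmul2l // => /eqP h.
exact/Fp_eq_mod.
Qed.

(** Modulo [p ^ 2], [(1 + p s) (1 + p t)] is [1 + p (s + t)]. *)
Lemma fqM m n : coprime m p -> coprime n p -> fq (m * n) = fq m + fq n.
Proof.
move=> cm cn; have cmn : coprime (m * n) p by rewrite coprimeMl cm.
rewrite -natrD; apply: fq_eq => //.
rewrite expnMn {1}(fermat_exp cm) {1}(fermat_exp cn).
set s := (_ %/ p)%N; set t := (_ %/ p)%N.
have -> : ((1 + p * s) * (1 + p * t) = s * t * p ^ 2 + (1 + p * (s + t)))%N.
  by ring.
by rewrite modnMDl.
Qed.

Lemma fq_prod (I : finType) (x : I -> nat) : (forall i, coprime (x i) p) ->
  fq (\prod_i x i) = \sum_i fq (x i).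
Proof.
move=> cx.
suff : coprime (\prod_i x i) p /\ fq (\prod_i x i) = \sum_i fq (x i) by case.
elim/big_rec2: _ => [|i s n _ [cn <-]].
  by rewrite coprime1n /fq exp1n subnn div0n.
by rewrite coprimeMl cx cn fqM.
Qed.

Lemma coprime_p2 n : coprime n (p ^ 2) = coprime n p.
Proof. by rewrite coprime_pexpr. Qed.

Lemma coprime_mod_p2 m n : (m = n %[mod p ^ 2])%N -> coprime m p -> coprime n p.
Proof.
by move=> h; rewrite -!coprime_p2 -coprime_modl h coprime_modl.
Qed.

Lemma fq_mod m n : (m = n %[mod p ^ 2])%N -> coprime m p -> fq m = fq n.
Proof.
move=> h cm; have cn := coprime_mod_p2 h cm.
apply: fq_eq => //; rewrite -(fermat_exp cn).
by rewrite -modnXm h modnXm.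
Qed.

Lemma exp_one_plus_p w k : ((1 + p * w) ^ k = 1 + p * (k * w) %[mod p ^ 2])%N.
Proof.
elim: k => [|k IH]; first by rewrite mul0n muln0.
rewrite expnS -modnMmr IH modnMmr.
have -> : ((1 + p * w) * (1 + p * (k * w)) =
   w * (k * w) * p ^ 2 + (1 + p * (k.+1 * w)))%N by ring.
by rewrite modnMDl.
Qed.

Lemma coprime_one_plus_p w : coprime (1 + p * w) p.
Proof. by rewrite coprime_sym /coprime addnC mulnC gcdnMDl gcdn1. Qed.

Lemma coprime_addp y z : coprime (y + p * z) p = coprime y p.
Proof. by rewrite -coprime_modl addnC mulnC modnMDl coprime_modl. Qed.

Lemma fq_one_plus_p w : fq (1 + p * w) = - w%:R.
Proof.
rewrite (fq_eq (coprime_one_plus_p w) (exp_one_plus_p w p.-1)).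
rewrite natrM -subn1 natrB // (_ : p%:R = 0) ?sub0r ?mulN1r //.
by apply/eqP; rewrite Fp_nat_eq0.
Qed.

(* Modulo [p^2], [y + p z = y (1 + p z y')] with [y y' = 1] modulo [p]. *)
Lemma fq_shift y z : coprime y p ->
  fq (y + p * z) = fq y - z%:R / y%:R.
Proof.
move=> cy; pose y' : nat := ((y%:R : 'F_p)^-1 : 'F_p).
have y'E : y'%:R = (y%:R)^-1 :> 'F_p by rewrite natr_Zp.
have hy : (y * y' = 1 %[mod p])%N.
  by apply/Fp_eq_mod; rewrite natrM y'E divff // coprime_neq0.
have h : (y + p * z = y * (1 + p * (z * y')) %[mod p ^ 2])%N.
  have -> : (y * (1 + p * (z * y')) = y + p * (z * (y * y')))%N by ring.
  apply/eqP; rewrite eqn_modDl -mulnn -!muln_modr eqn_pmul2l //.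
  by rewrite -modnMmr hy modnMmr muln1.
rewrite (fq_mod h) ?coprime_addp // fqM ?coprime_one_plus_p //.
by rewrite fq_one_plus_p natrM y'E.
Qed.

(** For a fixed residue [y] modulo [p], [fq (y + p * z)] is affine and injective in [z], so the
    value [s] selects at most one class modulo [p ^ 2] above [y]. Each class has at most
    [(X %/ p ^ 2).+1] members. *)
Lemma fq_fiber_card s X :
  (#|[set y : 'I_X.+1 | coprime y p && (fq y == s)]| <= p * (X %/ p ^ 2).+1)%N.
Proof.
have p2 : (0 < p ^ 2)%N by rewrite expn_gt0 p_gt0.
have hm (y : 'I_X.+1) : (y %% p < p)%N by rewrite ltn_mod.
have hd (y : 'I_X.+1) : (y %/ p ^ 2 < (X %/ p ^ 2).+1)%N.
  by rewrite ltnS leq_div2r // -ltnS.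
pose f (y : 'I_X.+1) := (Ordinal (hm y), Ordinal (hd y)).
have -> : (p * (X %/ p ^ 2).+1 = #|{: 'I_p * 'I_(X %/ p ^ 2).+1}|)%N.
  by rewrite card_prod !card_ord.
set A := [set y | _]; rewrite -(@card_in_imset _ _ f A) ?max_card //.
move=> y y'; rewrite !inE => /andP[cy /eqP hy] /andP[cy' /eqP hy'] [e1 e2].
(* The first two base-[p] digits of [u], and the rest; the second digit is what [fq] recovers from
   the first. *)
have dec (u : nat) : (u = u %% p + p * ((u %% p ^ 2) %/ p) + u %/ p ^ 2 * p ^ 2)%N.
  rewrite {1}(divn_eq u (p ^ 2)) addnC; congr (_ + _)%N.
  rewrite {1}(divn_eq (u %% p ^ 2) p) addnC mulnC; congr (_ + _)%N.
  by rewrite modn_dvdm // dvdn_exp.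
set z := ((y %% p ^ 2) %/ p)%N; set z' := ((y' %% p ^ 2) %/ p)%N.
have c0 : coprime (y %% p) p by rewrite coprime_modl.
have fE (u : nat) : coprime u p ->
    fq u = fq (u %% p) - ((u %% p ^ 2) %/ p)%:R / (u %% p)%:R.
  move=> cu; rewrite -fq_shift ?coprime_modl //; apply/esym/fq_mod.
    by rewrite -[in LHS](modnMDl (u %/ p ^ 2)) addnC -dec.
  by rewrite coprime_addp coprime_modl.
have zlt (u : nat) : ((u %% p ^ 2) %/ p < p)%N.
  by rewrite ltn_divLR // mulnn ltn_mod.
have hz : z = z'.
  have := fE y cy; rewrite hy -hy' (fE y' cy') -e1 => /addrI/oppr_inj/esym.
  move/(mulIf _); rewrite invr_eq0 coprime_neq0 // => /(_ isT)/Fp_eq_mod.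
  by rewrite (modn_small (zlt y)) (modn_small (zlt y')).
by apply: val_inj; rewrite /= (dec y) (dec y') -/z -/z' hz e1 e2.
Qed.

Lemma fermat_quotientE n : coprime n p ->
  exists t : nat, fermat_quotient p n = t /\ t%:R = fq n.
Proof.
move=> cn; exists ((n ^ p.-1 - 1) %/ p %% p)%N; split; last first.
  by rewrite Fp_nat_mod.
have n0 : (0 < n)%N.
  case: n cn => //; rewrite /coprime gcd0n => /eqP p1.
  by have := prime_gt1 p_pr; rewrite p1.
rewrite /fermat_quotient; case: ifP => [|_].
  rewrite dvdzE /= => pn; move: cn; rewrite coprime_sym prime_coprime //.
  by rewrite pn.
have -> : (n%:Z ^+ p.-1 - 1 = (n ^ p.-1 - 1)%N%:Z).
  by rewrite -!natz natrB ?expn_gt0 ?n0 // natrX.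
by rewrite divz_nat modz_nat.
Qed.

Lemma fq_sum_representableP (R : realType) (U : R) k (u : 'I_k -> nat) a :
  (forall i, coprime (u i) p) -> (forall i, (u i)%:R <= U) ->
  \sum_i fq (u i) = a%:R -> fq_sum_representable p U k a%:Z.
Proof.
move=> cu uU hsum; exists (fun i => (u i)%:Z); split; last first.
  move=> i; split; last by rewrite -pmulrn.
  rewrite lez_nat; case: (u i) (cu i) => //; rewrite /coprime gcd0n => /eqP p1.
  by have := prime_gt1 p_pr; rewrite p1.
have [t ht] := choice (fun i => fermat_quotientE (cu i)).
have -> : \sum_(i < k) fermat_quotient p (u i) = (\sum_i t i)%N%:Z.
  by rewrite -natz natr_sum; apply: eq_bigr => i _; rewrite (ht i).1 natz.
rewrite !modz_nat; congr Posz; apply/Fp_eq_mod; rewrite -hsum natr_sum.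
by apply: eq_bigr => i _; rewrite (ht i).2.
Qed.

End FermatQuotient.

(** * Additive characters and the large sieve *)

Section Characters.
Variable R : realType.
Local Notation C := (complex R).
Local Notation cabs := (@Normc.normc R).
Variables (p : nat) (p_pr : prime p) (om : C).
Hypotheses (om_p : om ^+ p = 1) (om_neq1 : om != 1).

Lemma cabs_ge0 (z : C) : 0 <= cabs z.
Proof. by case: z => a b; apply: sqrtr_ge0. Qed.

Lemma cabs_sqr (z : C) : ((cabs z ^+ 2)%:C = z * z^* )%C.
Proof.
case: z => a b; rewrite /= sqr_sqrtr ?addr_ge0 ?sqr_ge0 //.
by apply/eqP; rewrite eq_complex /=; apply/andP; split; apply/eqP; ring.
Qed.

Lemma cabsX (z : C) n : cabs (z ^+ n) = cabs z ^+ n.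
Proof.
elim: n => [|n IH]; first by rewrite !expr0 Normc.normc1.
by rewrite !exprS Normc.normcM IH.
Qed.

Lemma cabs_sum (I : Type) (r : seq I) (Q : pred I) (F : I -> C) :
  cabs (\sum_(i <- r | Q i) F i) <= \sum_(i <- r | Q i) cabs (F i).
Proof.
elim/big_rec2: _ => [|i y z _ h]; first by rewrite Normc.normc0.
by apply: le_trans (le_normcD _ _) _; rewrite lerD2l.
Qed.

Lemma cabs_prod (I : Type) (r : seq I) (Q : pred I) (F : I -> C) :
  cabs (\prod_(i <- r | Q i) F i) = \prod_(i <- r | Q i) cabs (F i).
Proof.
by elim/big_rec2: _ => [|i y z _ <-];
  rewrite ?Normc.normc1 ?Normc.normcM.
Qed.

Lemma cabs_sum_le (I : finType) (A : {pred I}) (F : I -> C) :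
  (forall i, cabs (F i) <= 1) -> cabs (\sum_(i in A) F i) <= #|A|%:R.
Proof.
move=> h; apply: le_trans (cabs_sum _ _ _) _.
by rewrite -sum1_card natr_sum; apply: ler_sum => i _.
Qed.

Lemma cabs_real (x : R) : cabs (x%:C)%C = `|x|.
Proof. by rewrite /= expr0n /= addr0 sqrtr_sqr. Qed.

Lemma cabs_nat n : cabs n%:R = n%:R.
Proof.
have -> : n%:R = (n%:R : R)%:C%C :> C by rewrite rmorph_nat.
by rewrite cabs_real ger0_norm.
Qed.

Definition chi (s : 'F_p) : C := om ^+ (s : nat).

Lemma chi_nat n : chi n%:R = om ^+ n.
Proof. by rewrite /chi (val_Fp_nat p_pr) expr_mod. Qed.

Lemma Fp_natE (s : 'F_p) : s = (s : nat)%:R.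
Proof. by rewrite natr_Zp. Qed.

Lemma chi0 : chi 0 = 1.
Proof. by rewrite (chi_nat 0). Qed.

Lemma chiD s t : chi (s + t) = chi s * chi t.
Proof. by rewrite (Fp_natE s) (Fp_natE t) -natrD !chi_nat exprD. Qed.

Lemma chi_sum (I : Type) (r : seq I) (Q : pred I) (F : I -> 'F_p) :
  chi (\sum_(i <- r | Q i) F i) = \prod_(i <- r | Q i) chi (F i).
Proof. exact: (big_morph chi chiD chi0). Qed.

Lemma cabs_om : cabs om = 1.
Proof.
apply/eqP; rewrite -(@eqrXn2 _ p) ?prime_gt0 ?cabs_ge0 // expr1n.
by rewrite -cabsX om_p Normc.normc1.
Qed.

Lemma cabs_chi s : cabs (chi s) = 1.
Proof. by rewrite cabsX cabs_om expr1n. Qed.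

Lemma chi_conj s : ((chi s)^* = chi (- s))%C.
Proof.
have h : chi s * chi (- s) = 1 by rewrite -chiD subrr chi0.
have nz : chi s != 0 by apply: contraTneq (oner_neq0 C) => e; rewrite -h e mul0r eqxx.
apply: (mulfI nz); rewrite h -cabs_sqr cabs_chi expr1n //.
Qed.

Lemma chiM_nat s n : chi (s * n%:R) = chi s ^+ n.
Proof.
elim: n => [|n IH]; first by rewrite mulr0 chi0 expr0.
by rewrite -natr1 mulrDr mulr1 chiD IH exprSr.
Qed.

Lemma chi_eq1 s : (chi s == 1) = (s == 0).
Proof.
apply/eqP/eqP => [h|->]; last exact: chi0.
apply/eqP; apply: contraNT om_neq1 => s_neq0; apply/eqP.
have : chi (s * s^-1) = 1.
  by rewrite (Fp_natE s^-1) chiM_nat h expr1n.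
by rewrite divff // (chi_nat 1) expr1.
Qed.

Lemma sum_chi s : \sum_l chi (l * s) = if s == 0 then p%:R else 0.
Proof.
case: eqP => [->|/eqP s0].
  rewrite (eq_bigr (fun=> 1)) => [|l _]; last by rewrite mulr0 chi0.
  by rewrite sumr_const card_Fp.
set Z := \sum_l _; have : chi s * Z = Z.
  rewrite /Z mulr_sumr [RHS](reindex_inj (addIr 1)) /=.
  by apply: eq_bigr => l _; rewrite -chiD mulrDl mul1r addrC.
move/eqP; rewrite -subr_eq0 -{2}[Z]mul1r -mulrBl mulf_eq0 subr_eq0 chi_eq1.
by rewrite (negPf s0) /= => /eqP.
Qed.

Lemma parseval (g : 'F_p -> C) :
  \sum_l cabs (\sum_s g s * chi (l * s)) ^+ 2 = p%:R * \sum_s cabs (g s) ^+ 2.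
Proof.
apply: (@complexI R); rewrite rmorphM !rmorph_sum /= rmorph_nat.
transitivity (\sum_l \sum_s \sum_t g s * (g t)^*%C * chi (l * (s - t))).
  apply: eq_bigr => l _; rewrite cabs_sqr (rmorph_sum (@conjc R)) mulr_suml.
  apply: eq_bigr => s _; rewrite mulr_sumr; apply: eq_bigr => t _.
  by rewrite (rmorphM (@conjc R)) /= chi_conj mulrBr chiD -mulrN; ring.
rewrite exchange_big mulr_sumr; apply: eq_bigr => s _.
rewrite exchange_big (bigD1 s) //= [X in _ + X]big1 ?addr0.
  by rewrite -mulr_sumr subrr sum_chi eqxx -cabs_sqr mulrC.
move=> t ts; rewrite -mulr_sumr sum_chi subr_eq0 eq_sym (negPf ts) mulr0 //.
Qed.

(** Group the sum by the value of [fq] and apply Parseval. By [fq_fiber_card] a value is taken at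
    most [M = D * p * (X %/ p ^ 2).+1] times, and [p * M <= D * (X + p ^ 2)]. *)
Lemma large_sieve (T : finType) (c : T -> C) (x : T -> nat) (D X : nat) :
  (forall t, cabs (c t) <= 1) -> (forall t, coprime (x t) p) ->
  (forall t, (x t <= X)%N) ->
  (forall y, (#|[set t | x t == y]| <= D)%N) ->
  \sum_l cabs (\sum_t c t * chi (l * fq p (x t))) ^+ 2 <=
  (#|T| * D * (X + p ^ 2))%N%:R.
Proof.
move=> hc cx xX hD.
pose A s := [set t | fq p (x t) == s].
pose g s := \sum_(t in A s) c t.
have -> : \sum_l cabs (\sum_t c t * chi (l * fq p (x t))) ^+ 2 =
    \sum_l cabs (\sum_s g s * chi (l * s)) ^+ 2.
  apply: eq_bigr => l _; congr (cabs _ ^+ 2).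
  rewrite (partition_big (fun t => fq p (x t)) predT) //=.
  apply: eq_bigr => s _; rewrite /g mulr_suml.
  rewrite [RHS](eq_bigl (fun t => fq p (x t) == s)) => [|t]; last by rewrite inE.
  by apply: eq_bigr => t /eqP ->.
rewrite parseval.
set M := (D * (p * (X %/ p ^ 2).+1))%N.
have hA s : (#|A s| <= M)%N.
  have -> : #|A s| = (\sum_(y < X.+1) #|[set t in A s | x t == y]|)%N.
    rewrite -sum1_card (partition_big (fun t => inord (x t) : 'I_X.+1) predT) //=.
    apply: eq_bigr => y _; rewrite sum1dep_card; apply: eq_card => t.
    by rewrite !inE; congr (_ && _); rewrite -val_eqE /= inordK // ltnS.
  apply: leq_trans (_ : \sum_(y < X.+1 | coprime y p && (fq p y == s)) D <= _)%N.
    rewrite [leqRHS]big_mkcond /=; apply: leq_sum => y _.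
    case: ifP => h.
      apply: leq_trans (hD y); apply: subset_leq_card; apply/fintype.subsetP => t.
      by rewrite !inE => /andP[].
    rewrite leqn0 cards_eq0; apply/eqP/setP => t; rewrite !inE.
    by apply/negP => /andP[/eqP ht /eqP ty]; move: h; rewrite -ty cx ht eqxx.
  rewrite sum_nat_cond_const mulnC leq_mul2l.
  by apply/orP; right; have := fq_fiber_card p_pr s X; rewrite cardsE.
have h1 : \sum_s cabs (g s) ^+ 2 <= (#|T| * M)%N%:R.
  apply: le_trans (_ : \sum_s (#|A s| * M)%N%:R <= _).
    apply: ler_sum => s _.
    have h : cabs (g s) <= #|A s|%:R by apply: cabs_sum_le.
    rewrite natrM expr2 ler_pM ?cabs_ge0 //.
    by apply: le_trans h _; rewrite ler_nat.
  rewrite -natr_sum ler_nat -big_distrl leq_mul2r; apply/orP; right.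
  rewrite -(cardsT T) -sum1_card.
  rewrite [leqRHS](partition_big (fun t => fq p (x t)) predT) //=.
  apply/eq_leq/eq_bigr => s _; rewrite -sum1_card; apply: eq_bigl => t.
  by rewrite !inE.
apply: le_trans (ler_wpM2l (ler0n _ p) h1) _.
rewrite -natrM ler_nat /M mulnCA -!mulnA leq_mul2l; apply/orP; right.
rewrite mulnCA leq_mul2l; apply/orP; right.
by rewrite mulnA mulnn mulnSr leq_add2r mulnC leq_divM.
Qed.

End Characters.

Lemma exists_root_of_unity (R : realType) p : prime p ->
  exists2 om : complex R, om ^+ p = 1 & om != 1.
Proof.
move=> p_pr; pose Q : {poly (complex R)} := \sum_(i < p) 'X^i.
have QE : Q = \poly_(i < p) 1.
  by rewrite poly_def; apply: eq_bigr => i _; rewrite scale1r.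
have sQ : size Q = p.
  rewrite QE; apply: size_poly_eq => /=.
  exact: oner_neq0.
have [|om /rootP h] := closed_rootP Q _.
  by rewrite sQ; have := prime_gt1 p_pr; case: (p) => [|[|]].
have hs : \sum_(i < p) om ^+ i = 0.
  transitivity (Q.[om]) => //; rewrite /Q horner_sum.
  by apply: eq_bigr => i _; rewrite hornerXn.
exists om.
  by apply/eqP; rewrite -subr_eq0 subrX1 hs mulr0.
apply: contraTneq (prime_gt0 p_pr) => e; move: hs; rewrite e.
rewrite (eq_bigr (fun=> 1)) => [|i _]; last by rewrite expr1n.
by rewrite sumr_const card_ord => /eqP; rewrite pnatr_eq0 => /eqP ->.
Qed.

(** * Logarithmic derivatives and finite inequalities *)

Section LogarithmicDerivative.
Variable F : finFieldType.

Lemma deriv_prod_horner (I : Type) (s : seq I) (be : I -> F) (y : F) :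
  (forall i, y + be i != 0) ->
  (\prod_(i <- s) ('X + (be i)%:P))^`().[y] =
  (\prod_(i <- s) (y + be i)) * \sum_(i <- s) (y + be i)^-1.
Proof.
move=> nz; elim: s => [|i s IH]; first by rewrite !big_nil derivC horner0 mulr0.
rewrite !big_cons derivM derivD derivX derivC addr0 mul1r hornerD hornerM IH.
rewrite !hornerE horner_prod.
under eq_bigr do rewrite !hornerE.
by rewrite /= [in RHS]mulrDr [in RHS](mulrAC (y + be i)) divff // mul1r.
Qed.

Lemma size_prod_XaddC (I : finType) (be : I -> F) :
  size (\prod_i ('X + (be i)%:P)) = #|I|.+1.
Proof.
rewrite (eq_bigr (fun i => 'X - (- be i)%:P)) => [|i _]; last first.
  by rewrite polyCN opprK.
by rewrite size_prod_XsubC /index_enum -enumT cardE.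
Qed.

(** Compare orders of vanishing at [c]. If [S = S1 * ('X - c) ^ m.+1] with [S1.[c] != 0], dividing
    the identity by [('X - c) ^ m] and evaluating at [c] gives [0 = Q.[c] * S1.[c] * m.+1], where
    [m.+1] is nonzero in [F]. *)
Lemma root_of_wronskian0 (Q S : {poly F}) c :
  (forall m, (0 < m < size S)%N -> m%:R != 0 :> F) -> S != 0 ->
  Q^`() * S = Q * S^`() -> root S c -> root Q c.
Proof.
move=> hm S0 hW rS; apply: contraT => rQ.
have [m [S1 rS1 SE]] := multiplicity_XsubC S c; rewrite S0 /= in rS1.
have m0 : (0 < m)%N.
  by case: m SE => // SE; move: rS; rewrite SE expr0 mulr1 (negPf rS1).
case: m m0 SE => // m _ SE.
have S10 : S1 != 0 by apply: contraNneq S0 => e; rewrite SE e mul0r.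
have mS : (m.+1 < size S)%N.
  rewrite SE size_mul ?expf_neq0 ?polyXsubC_eq0 // size_exp_XsubC.
  by rewrite addnS /= -[leqLHS]add1n leq_add2r size_poly_gt0.
have := hm m.+1 mS; rewrite SE in hW.
have hX : ('X - c%:P) ^+ m != 0 :> {poly F} by rewrite expf_neq0 // polyXsubC_eq0.
have E : Q^`() * S1 * ('X - c%:P) =
    Q * (S1^`() * ('X - c%:P) + S1 * m.+1%:R).
  apply: (mulIf hX); move: hW.
  rewrite derivM deriv_exp derivXsubC mul1r /= !exprS -mulr_natr => hW.
  by rewrite -!mulrA hW; ring.
move: (congr1 (fun P => P.[c]) E).
rewrite !hornerE subrr !mulr0 add0r => /esym/eqP.
rewrite -polyC_natr hornerC mulf_eq0 -rootE (negPf rQ) mulf_eq0 -rootE.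
by rewrite (negPf rS1) /= => /eqP ->; rewrite eqxx.
Qed.

(** The two sums are the logarithmic derivatives of [Q] and [S], so each solution is a root of
    [W = Q' S - Q S'], whose size is at most [2 * r]. [W] is nonzero because [- ga j] is a root of
    [S] and not of [Q]. *)
Lemma card_inv_sum_eq (r : nat) (be ga : 'I_r -> F) :
  (forall m, (0 < m <= r)%N -> m%:R != 0 :> F) ->
  (exists j, forall i, ga j != be i) ->
  (#|[set y : F | [&& [forall i, (y + be i)%R != 0%R],
       [forall i, (y + ga i)%R != 0%R]
     & (\sum_i (y + be i)^-1)%R == (\sum_i (y + ga i)^-1)%R]]| <= 2 * r)%N.
Proof.
move=> hm [j hj].
pose Q := \prod_i ('X + (be i)%:P); pose S := \prod_i ('X + (ga i)%:P).
have sQ : size Q = r.+1 by rewrite size_prod_XaddC card_ord.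
have sS : size S = r.+1 by rewrite size_prod_XaddC card_ord.
have Q0 : Q != 0 by rewrite -size_poly_gt0 sQ.
have S0 : S != 0 by rewrite -size_poly_gt0 sS.
pose W := Q^`() * S - Q * S^`().
have W0 : W != 0.
  apply/negP => /eqP/subr0_eq hW.
  have rS : root S (- ga j).
    rewrite rootE /S horner_prod (bigD1 j) //= !hornerE addNr mul0r //.
  have := @root_of_wronskian0 Q S (- ga j) _ S0 hW rS.
  rewrite sS => /(_ hm); rewrite rootE /Q horner_prod prodf_seq_eq0.
  case/hasP => i _ /=; rewrite !hornerE addrC subr_eq0 => /eqP e.
  by have := hj i; rewrite e eqxx.
have sW : (size W <= 2 * r)%N.
  apply: leq_trans (size_polyD _ _) _; rewrite size_polyN geq_max; apply/andP; split.
    apply: leq_trans (size_polyMleq _ _) _.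
    have := lt_size_deriv Q0; rewrite sS sQ; lia.
  apply: leq_trans (size_polyMleq _ _) _.
  by have := lt_size_deriv S0; rewrite sS sQ ltnS addSn mul2n -addnn leq_add2l.
set A := [set y | _]; rewrite cardE.
apply: ltnW; apply: leq_trans sW; apply: max_poly_roots => //; last exact: enum_uniq.
apply/allP => y; rewrite mem_enum inE => /and3P[/forallP nb /forallP ng /eqP e].
rewrite rootE /W hornerD hornerN !hornerM !deriv_prod_horner //.
rewrite !horner_prod.
under [X in _ * X - _]eq_bigr do rewrite !hornerE.
under [X in _ - X * _]eq_bigr do rewrite !hornerE.
by rewrite e; apply/eqP; ring.
Qed.

End LogarithmicDerivative.

Section FiniteInequalities.
Variable R : realType.

Lemma cauchy_schwarz (I : finType) (a b : I -> R) :
  (\sum_i a i * b i) ^+ 2 <= (\sum_i a i ^+ 2) * (\sum_i b i ^+ 2).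
Proof.
have h : 0 <= \sum_i \sum_j (a i * b j - a j * b i) ^+ 2.
  by apply: sumr_ge0 => i _; apply: sumr_ge0 => j _; apply: sqr_ge0.
have e : \sum_i \sum_j (a i * b j - a j * b i) ^+ 2 =
    2 * ((\sum_i a i ^+ 2) * (\sum_i b i ^+ 2) - (\sum_i a i * b i) ^+ 2).
  transitivity (\sum_i \sum_j (a i ^+ 2 * b j ^+ 2 + b i ^+ 2 * a j ^+ 2
      - 2 * (a i * b i * (a j * b j)))).
    by apply: eq_bigr => i _; apply: eq_bigr => j _; ring.
  under eq_bigr do rewrite sumrB big_split /= -!mulr_sumr.
  rewrite sumrB big_split /= -mulr_sumr -!mulr_suml; ring.
rewrite e pmulr_rge0 // subr_ge0 in h; exact: h.
Qed.

(** Exponents that are powers of 2 let repeated squaring with Cauchy-Schwarz do the work; this is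
    why the moments below have order [2 * 2 ^ j]. *)
Lemma power_mean (I : finType) (t : I -> R) j : (forall i, 0 <= t i) ->
  (\sum_i t i) ^+ (2 ^ j) <= #|I|%:R ^+ (2 ^ j).-1 * \sum_i t i ^+ (2 ^ j).
Proof.
move=> t0; elim: j => [|j IH]; first by rewrite expr0 mul1r.
have h : (\sum_i t i ^+ (2 ^ j)) ^+ 2 <= #|I|%:R * \sum_i t i ^+ (2 ^ j.+1).
  have := cauchy_schwarz (fun=> 1) (fun i => t i ^+ (2 ^ j)).
  under eq_bigr do rewrite mul1r.
  under [X in _ <= X * _]eq_bigr do rewrite expr1n.
  under [X in _ <= _ * X]eq_bigr do rewrite -exprM -expnSr.
  by rewrite sumr_const.
have -> : (\sum_i t i) ^+ (2 ^ j.+1) = ((\sum_i t i) ^+ (2 ^ j)) ^+ 2.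
  by rewrite -exprM -expnSr.
apply: le_trans (_ : (#|I|%:R ^+ (2 ^ j).-1 * \sum_i t i ^+ (2 ^ j)) ^+ 2 <= _).
  rewrite lerXn2r // nnegrE ?exprn_ge0 ?sumr_ge0 //.
  by rewrite mulr_ge0 ?exprn_ge0 // sumr_ge0 // => i _; rewrite exprn_ge0.
rewrite exprMn; apply: le_trans (ler_wpM2l _ h) _; first exact: sqr_ge0.
rewrite mulrA -exprM -exprSr (_ : ((2 ^ j).-1 * 2).+1 = (2 ^ j.+1).-1)%N //.
by rewrite expnS; have := expn_gt0 2 j; case: (2 ^ j)%N => //= m _; lia.
Qed.

(* Hoelder's inequality with exponents [2r / (2r - 2)], [2r], [2r]. *)
Lemma hoelder_pushforward (I X : finType) (xi : I -> X) (t : X -> R) j :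
  (forall x, 0 <= t x) ->
  (\sum_i t (xi i)) ^+ (2 * 2 ^ j) <=
  #|I|%:R ^+ (2 * (2 ^ j).-1) * #|[set q : I * I | xi q.1 == xi q.2]|%:R *
  \sum_x t x ^+ (2 * 2 ^ j).
Proof.
move=> t0.
(* Fibre sizes of [xi]; their second moment counts the collisions, and one more Cauchy-Schwarz
   separates it from the moment of [t]. *)
pose nu x : R := #|[set i | xi i == x]|%:R.
have h1 : \sum_i t (xi i) ^+ (2 ^ j) = \sum_x nu x * t x ^+ (2 ^ j).
  rewrite (partition_big xi predT) //=; apply: eq_bigr => x _.
  rewrite (eq_bigr (fun=> t x ^+ (2 ^ j))) => [|i /eqP -> //].
  by rewrite sumr_const mulr_natl /nu cardsE.
have h2 : \sum_x nu x ^+ 2 = #|[set q : I * I | xi q.1 == xi q.2]|%:R.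
  transitivity (\sum_x \sum_(q : I * I | (xi q.1 == x) && (xi q.2 == x)) 1 : R).
    apply: eq_bigr => x _.
    rewrite -(pair_big (fun i => xi i == x) (fun i => xi i == x) (fun _ _ => 1)) /=.
    have e : \sum_(i | xi i == x) 1 = nu x by rewrite sumr_const /nu cardsE.
    by rewrite e sumr_const expr2 -[RHS]mulr_natr /nu cardsE.
  rewrite -sum1_card natr_sum.
  rewrite [RHS](partition_big (fun q => xi q.1) predT) //=.
  apply: eq_bigr => x _; apply: eq_bigl => q; rewrite inE andbC.
  by case: (xi q.1 =P x) => [->|_]; rewrite ?andbF // !andbT eq_sym.
have h3 := power_mean j (fun i => t0 (xi i)).
rewrite h1 in h3.
have h4 := cauchy_schwarz nu (fun x => t x ^+ (2 ^ j)); rewrite h2 in h4.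
have h5 : 0 <= \sum_i t (xi i) by apply: sumr_ge0.
rewrite mulnC exprM; apply: le_trans (_ : (#|I|%:R ^+ (2 ^ j).-1 *
    \sum_x nu x * t x ^+ (2 ^ j)) ^+ 2 <= _).
  rewrite lerXn2r // nnegrE ?exprn_ge0 //.
  rewrite mulr_ge0 ?exprn_ge0 // sumr_ge0 // => x _.
  by rewrite mulr_ge0 ?exprn_ge0.
rewrite exprMn -exprM mulnC -mulrA ler_wpM2l ?exprn_ge0 //.
apply: le_trans h4 _; rewrite ler_wpM2l // ler_sum // => x _.
by rewrite -exprM mulnC.
Qed.

End FiniteInequalities.

(** * Burgess's method modulo [p^2] *)

Section Burgess.
Variable R : realType.
Local Notation C := (complex R).
Local Notation cabs := (@Normc.normc R).
Variables (p : nat) (p_pr : prime p) (om : C).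
Hypotheses (om_p : om ^+ p = 1) (om_neq1 : om != 1).
Variable l : 'F_p.
Local Notation chi := (@chi R p om).
Local Notation fq := (fq p).

(** A Dirichlet character modulo [p ^ 2], of order dividing [p]. *)
Definition psi (n : nat) : C := if coprime n p then chi (l * fq n) else 0.

Lemma cabs_psi n : cabs (psi n) <= 1.
Proof.
rewrite /psi; case: ifP => _; first by rewrite (cabs_chi p_pr om_p).
by rewrite Normc.normc0 ler01.
Qed.

Lemma psi_mod m n : (m = n %[mod p ^ 2])%N -> psi m = psi n.
Proof.
move=> h; rewrite /psi; have [cm|ncm] := boolP (coprime m p).
  by rewrite (coprime_mod_p2 h cm) (fq_mod p_pr h cm).
by case: ifP => // cn; rewrite (coprime_mod_p2 (esym h) cn) in ncm.
Qed.

Lemma psiM m n : psi (m * n) = psi m * psi n.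
Proof.
rewrite /psi coprimeMl; have [cm|] := boolP (coprime m p); last by rewrite mul0r.
have [cn|] := boolP (coprime n p); last by rewrite mulr0.
by rewrite /= (fqM p_pr cm cn) mulrDr (chiD p_pr om_p).
Qed.

Lemma cabs_sum_psi (I : Type) (s : seq I) (f : I -> nat) :
  cabs (\sum_(i <- s) psi (f i)) <= (size s)%:R.
Proof.
apply: le_trans (cabs_sum _ _ _) _.
rewrite -sum1_size natr_sum; apply: ler_sum => i _; exact: cabs_psi.
Qed.

Hypothesis l_neq0 : l != 0.

(** The pair [x] stands for the residue [x.1 + p * x.2] modulo [p ^ 2], so that complete sums can be
    taken over the digit [x.2] first. *)
Definition short_sum (B : nat) (x : 'F_p * 'F_p) : C :=
  \sum_(b < B) psi (x.1 + p * x.2 + b.+1).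

Lemma small_natr_neq0 m : (0 < m < p)%N -> m%:R != 0 :> 'F_p.
Proof. by move=> h; apply: coprime_neq0 => //; apply: lt_coprime. Qed.

(** For fixed [y], [fq_shift] turns each term into a constant times the additive character of [z]
    with frequency [- l / (y + b)]. Expanding the [r]-th power and applying Parseval in [z] leaves
    the pairs of tuples with equal sums of frequencies. *)
Lemma short_sum_moment_fiber (B r : nat) (y : 'F_p) :
  \sum_(z : 'F_p) cabs (short_sum B (y, z)) ^+ (2 * r) <=
  (p * #|[set q : {ffun 'I_r -> 'I_B} * {ffun 'I_r -> 'I_B} |
    [&& [forall i, (y + (q.1 i).+1%:R)%R != 0%R],
        [forall i, (y + (q.2 i).+1%:R)%R != 0%R]
     & (\sum_i (y + (q.1 i).+1%:R)^-1)%R ==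
       (\sum_i (y + (q.2 i).+1%:R)^-1)%R]]|)%:R.
Proof.
pose ok b := y + b.+1%:R != 0.
pose ib b : 'F_p := - l * (y + b.+1%:R)^-1.
pose c b : C := if ok b then chi (l * fq (y + b.+1)) else 0.
have natE b : ((y : nat) + b.+1)%:R = y + b.+1%:R :> 'F_p.
  by rewrite natrD natr_Zp.
have okE b : ok b = coprime (y + b.+1) p.
  by rewrite /ok -natE Fp_nat_eq0 // coprime_sym prime_coprime.
have cE b : cabs (c b) = (ok b)%:R.
  rewrite /c; case: (ok b); first by rewrite (cabs_chi p_pr om_p).
  by rewrite Normc.normc0.
have TE z : short_sum B (y, z) = \sum_(b < B) c b * chi (z * ib b).
  apply: eq_bigr => b _ /=.
  have -> : ((y : nat) + p * z + b.+1 = y + b.+1 + p * z)%N by ring.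
  rewrite /psi coprime_addp // -okE /c; case: ifP => [okb|]; last by rewrite mul0r.
  rewrite okE in okb; rewrite (fq_shift p_pr) // natE natr_Zp.
  rewrite -(chiD p_pr om_p); congr (chi _); rewrite /ib; ring.
pose S (f : {ffun 'I_r -> 'I_B}) := \sum_i ib (f i).
pose g s := \sum_(f | S f == s) \prod_i c (f i).
have TrE z : short_sum B (y, z) ^+ r = \sum_s g s * chi (z * s).
  have -> : short_sum B (y, z) ^+ r = \prod_(i < r) short_sum B (y, z).
    by rewrite prodr_const card_ord.
  rewrite TE bigA_distr_bigA /= (partition_big S predT) //=.
  apply: eq_bigr => s _; rewrite /g mulr_suml; apply: eq_bigr => f /eqP <-.
  by rewrite big_split /= /S mulr_sumr (chi_sum p_pr om_p).
have -> : \sum_z cabs (short_sum B (y, z)) ^+ (2 * r) =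
    \sum_z cabs (\sum_s g s * chi (z * s)) ^+ 2.
  by apply: eq_bigr => z _; rewrite -TrE cabsX -exprM mulnC.
rewrite (parseval p_pr om_p om_neq1) natrM ler_wpM2l //.
pose okf (f : {ffun 'I_r -> 'I_B}) := [forall i, ok (f i)].
have gle s : cabs (g s) <= #|[set f | okf f && (S f == s)]|%:R.
  apply: le_trans (cabs_sum _ _ _) _.
  rewrite -sum1_card natr_sum big_mkcond [leRHS]big_mkcond /=.
  apply: ler_sum => f _; rewrite inE; case: (S f == s); rewrite ?andbT ?andbF //.
  rewrite cabs_prod; case: ifP => [/forallP h|].
    by rewrite big1 // => i _; rewrite cE h.
  move/negbT; rewrite negb_forall => /existsP[i hi].
  by rewrite (bigD1 i) //= cE (negPf hi) mul0r.
apply: le_trans (_ : \sum_s #|[set f | okf f && (S f == s)]|%:R ^+ 2 <= _).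
  by apply: ler_sum => s _; rewrite lerXn2r // nnegrE ?cabs_ge0.
under eq_bigr do rewrite -natrX.
rewrite -natr_sum ler_nat.
set E := [set q | _]; rewrite -[leqRHS]sum1_card.
rewrite [leqRHS](partition_big (fun q => S q.1) predT) //=.
apply: leq_sum => s _; rewrite sum1dep_card -mulnn -cardsX.
apply: subset_leq_card; apply/fintype.subsetP => q.
rewrite !inE => /andP[/andP[ok1 /eqP e1] /andP[ok2 /eqP e2]].
rewrite e1 eqxx andbT.
have ok1' : [forall i, (y + (q.1 i).+1%:R)%R != 0%R] := ok1.
have ok2' : [forall i, (y + (q.2 i).+1%:R)%R != 0%R] := ok2.
rewrite ok1' ok2' /=; apply/eqP.
have ln0 : - l != 0 by rewrite oppr_eq0.
by apply: (mulfI ln0); rewrite !mulr_sumr -[LHS]/(S q.1) -[RHS]/(S q.2) e1 e2.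
Qed.

(** If every entry of the second tuple occurs in the first, all [p] values of [y] are allowed, but
    there are at most [B ^ r * r ^ r] such pairs. For any other pair [card_inv_sum_eq] leaves at
    most [2 * r] values of [y]. *)
Lemma short_sum_moment (B r : nat) : (B < p)%N -> (r < p)%N ->
  \sum_x cabs (short_sum B x) ^+ (2 * r) <=
  (p * (B ^ r * r ^ r * p + B ^ r * B ^ r * (2 * r)))%:R.
Proof.
move=> Bp rp.
pose T := {ffun 'I_r -> 'I_B}.
pose E (y : 'F_p) := [set q : T * T |
    [&& [forall i, (y + (q.1 i).+1%:R)%R != 0%R],
        [forall i, (y + (q.2 i).+1%:R)%R != 0%R]
     & (\sum_i (y + (q.1 i).+1%:R)^-1)%R ==
       (\sum_i (y + (q.2 i).+1%:R)^-1)%R]].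
rewrite -(pair_bigA _ (fun y z => cabs (short_sum B (y, z)) ^+ (2 * r))) /=.
apply: le_trans (ler_sum _ (fun y _ => short_sum_moment_fiber B r y)) _.
rewrite -natr_sum ler_nat -big_distrr leq_mul2l; apply/orP; right.
have -> : (\sum_y #|E y| = \sum_(q : T * T) #|[set y | q \in E y]|)%N.
  under eq_bigr do rewrite -sum1_card big_mkcond /=.
  rewrite exchange_big; apply: eq_bigr => q _.
  by rewrite -sum1_card [RHS]big_mkcond; apply: eq_bigr => y _; rewrite inE.
pose triv (q : T * T) := [forall j, [exists i, q.2 j == q.1 i]].
rewrite (bigID triv) /=; apply: leq_add; last first.
  apply: leq_trans (_ : \sum_(q : T * T) 2 * r <= _)%N; last first.
    by rewrite sum_nat_const card_prod !card_ffun !card_ord.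
  rewrite [leqLHS]big_mkcond; apply: leq_sum => q _; case: ifP => // hq.
  apply: leq_trans (@card_inv_sum_eq _ r (fun i => (q.1 i).+1%:R)
    (fun i => (q.2 i).+1%:R) _ _).
  - by apply/eq_leq/eq_card => y; rewrite !inE.
  - by move=> m /andP[m0 mr]; apply: small_natr_neq0; rewrite m0 (leq_ltn_trans mr).
  move: hq; rewrite negb_forall => /existsP[j].
  rewrite negb_exists => /forallP hj; exists j => i.
  apply: contraNneq (hj i) => /(Fp_eq_mod p_pr).
  have lt (b : 'I_B) : (b.+1 < p)%N by apply: leq_ltn_trans Bp.
  by rewrite !modn_small // => -[/val_inj ->].
apply: leq_trans (_ : \sum_(q | triv q) p <= _)%N.
  apply: leq_sum => q _; rewrite -[leqRHS](card_Fp p_pr); exact: max_card.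
rewrite sum_nat_cond_const leq_mul2r; apply/orP; right.
(* A pair of the first kind is determined by its first tuple and by a choice of positions in it. *)
pose h (w : T * {ffun 'I_r -> 'I_r}) : T * T := (w.1, [ffun j => w.1 (w.2 j)]).
have -> : (B ^ r * r ^ r = #|{: T * {ffun 'I_r -> 'I_r}}|)%N.
  by rewrite card_prod !card_ffun !card_ord.
apply: leq_trans (leq_imset_card h predT).
apply: subset_leq_card; apply/fintype.subsetP => q; rewrite inE => /forallP hq.
have hq' j : exists i, q.2 j == q.1 i by apply/existsP.
apply/imsetP; exists (q.1, [ffun j => xchoose (hq' j)]) => //.
rewrite /h /= [LHS]surjective_pairing; congr (_, _); apply/ffunP => j.
by rewrite !ffunE; apply/eqP/(xchooseP (hq' j)).
Qed.

Lemma exists_inv_mod a m : (0 < a)%N -> coprime a m ->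
  exists a', (a * a' = 1 %[mod m])%N.
Proof.
move=> a0 /(coprimeP _ a0)[[u v] /= h].
exists u; have -> : (a * u = v * m + 1)%N by lia.
by rewrite modnMDl.
Qed.

Lemma shift_sum N h : cabs (\sum_(n < N) psi n.+1 - \sum_(n < N) psi (n.+1 + h))
  <= 2 * h%:R.
Proof.
have e1 : \sum_(n < N) psi n.+1 = \sum_(0 <= n < N) psi n.+1 by rewrite big_mkord.
have e2 : \sum_(n < N) psi (n.+1 + h) = \sum_(h <= n < h + N) psi n.+1.
  rewrite [RHS](_ : _ = \sum_(0 + h <= n < h + N) psi n.+1) //.
  rewrite big_addn addKn big_mkord; apply: eq_bigr => n _.
  by rewrite addSn.
have e3 : \sum_(0 <= n < N) psi n.+1 + \sum_(N <= n < h + N) psi n.+1 =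
    \sum_(0 <= n < h) psi n.+1 + \sum_(h <= n < h + N) psi n.+1.
  by rewrite -!big_cat_nat ?leq_addl ?leq_addr.
rewrite e1 e2.
have -> : \sum_(0 <= n < N) psi n.+1 - \sum_(h <= n < h + N) psi n.+1 =
    \sum_(0 <= n < h) psi n.+1 - \sum_(N <= n < h + N) psi n.+1.
  by apply/eqP; rewrite subr_eq addrAC -e3 addrK.
apply: le_trans (le_normcD _ _) _; rewrite normcN mulr2n mulrDl !mul1r lerD //.
  by apply: le_trans (cabs_sum_psi _ _) _; rewrite size_iota subn0.
by apply: le_trans (cabs_sum_psi _ _) _; rewrite size_iota addnK.
Qed.

(** Replace [n] by [n + a b] and average over [a <= A], [b <= B]; the end terms cost [2 (A B) ^ 2].
    As [psi (n + a b) = psi a * psi (n / a + b)], the rest is at most [Z], the sum of the moduli of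
    short sums at the points [n / a]. Hoelder bounds [Z] by collisions of these points and a
    complete moment. *)
Lemma burgess_shift (N A B D j : nat) :
  (0 < A)%N -> (0 < B)%N -> (N + A * B < p)%N -> (A * N < p ^ 2)%N ->
  (2 ^ j < p)%N ->
  (forall x, 0 < x <= A * N -> ndiv x <= D)%N ->
  exists Z : R, [/\ 0 <= Z,
    (A * B)%:R * cabs (\sum_(n < N) psi n.+1) <= Z + 2 * (A * B)%:R ^+ 2 &
    Z ^+ (2 * 2 ^ j) <= ((A * N) ^ (2 * (2 ^ j).-1) * (A * N * D) *
      (p * (B ^ (2 ^ j) * (2 ^ j) ^ (2 ^ j) * p +
            B ^ (2 ^ j) * B ^ (2 ^ j) * (2 * 2 ^ j))))%:R].
Proof.
move=> A0 B0 NABp ANp rp hD.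
have p_gt0 := prime_gt0 p_pr.
have p2_gt0 : (0 < p ^ 2)%N by rewrite expn_gt0 p_gt0.
have Ap : (A < p)%N.
  by apply: leq_ltn_trans NABp; rewrite (leq_trans (leq_pmulr A B0)) // leq_addl.
have Bp : (B < p)%N.
  by apply: leq_ltn_trans NABp; rewrite (leq_trans (leq_pmull B A0)) // leq_addl.
have ca (a : 'I_A) : coprime a.+1 p.
  by apply: lt_coprime => //=; apply: leq_ltn_trans Ap.
have inv (a : 'I_A) : exists a', (a.+1 * a' = 1 %[mod p ^ 2])%N.
  by apply: exists_inv_mod; rewrite // coprime_p2.
have [ainv hinv] := choice inv.
(* The quotient [n / a] modulo [p ^ 2]; [xi] lists its two base-[p] digits. *)
pose x (i : 'I_A * 'I_N) : nat := ((i.2.+1 * ainv i.1) %% p ^ 2)%N.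
have hx (i : 'I_A * 'I_N) : (i.1.+1 * x i = i.2.+1 %[mod p ^ 2])%N.
  rewrite modnMmr mulnCA -modnMmr hinv modnMmr muln1 //.
have xlt i : (x i < p ^ 2)%N by rewrite ltn_mod.
pose xi i : 'F_p * 'F_p := ((x i %% p)%:R, (x i %/ p)%:R).
have xi1 i : ((xi i).1 : nat) = (x i %% p)%N by rewrite /= val_Fp_nat // modn_mod.
have xi2 i : ((xi i).2 : nat) = (x i %/ p)%N.
  by rewrite /= val_Fp_nat // modn_small // ltn_divLR // mulnn.
have xiE i : ((xi i).1 + p * (xi i).2 = x i)%N.
  by rewrite xi1 xi2 addnC mulnC -divn_eq.
pose t y := cabs (short_sum B y).
have t0 y : 0 <= t y by apply: cabs_ge0.
exists (\sum_i t (xi i)); split.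
- by apply: sumr_ge0.
- have step (a : 'I_A) (b : 'I_B) : cabs (\sum_(n < N) psi n.+1 -
      \sum_(n < N) psi (n.+1 + a.+1 * b.+1)) <= 2 * (A * B)%:R.
    apply: le_trans (shift_sum _ _) _; rewrite ler_pM2l //.
    by rewrite ler_nat leq_mul.
  set S := \sum_(n < N) psi n.+1 in step *.
  have e1 : (A * B)%:R * S = \sum_(a < A) \sum_(b < B)
       (S - \sum_(n < N) psi (n.+1 + a.+1 * b.+1)) +
       \sum_(a < A) \sum_(b < B) \sum_(n < N) psi (n.+1 + a.+1 * b.+1).
    under eq_bigr do rewrite sumrB.
    rewrite sumrB subrK; under eq_bigr do rewrite sumr_const card_ord.
    by rewrite sumr_const card_ord -mulrnA mulr_natl mulnC.
  have e2 : \sum_(a < A) \sum_(b < B) \sum_(n < N) psi (n.+1 + a.+1 * b.+1) =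
      \sum_(i : 'I_A * 'I_N) psi i.1.+1 * short_sum B (xi i).
    rewrite -(pair_bigA _ (fun (a : 'I_A) (n : 'I_N) => psi a.+1 * short_sum B (xi (a, n)))) /=.
    apply: eq_bigr => a _; rewrite exchange_big; apply: eq_bigr => n _.
    rewrite /short_sum mulr_sumr; apply: eq_bigr => b _.
    rewrite xiE -psiM; apply: psi_mod.
    by rewrite mulnDr -modnDml -[in RHS]modnDml (hx (a, n)).
  have e3 : (A * B)%:R * cabs S = cabs ((A * B)%:R * S).
    by rewrite Normc.normcM cabs_nat.
  rewrite e3 e1 e2 addrC; apply: le_trans (le_normcD _ _) _; apply: lerD.
    apply: le_trans (cabs_sum _ _ _) _; apply: ler_sum => i _.
    by rewrite Normc.normcM ler_piMl ?cabs_ge0 ?cabs_psi.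
  apply: le_trans (cabs_sum _ _ _) _.
  apply: le_trans (_ : \sum_(a < A) \sum_(b < B) 2 * (A * B)%:R <= _).
    apply: ler_sum => a _; apply: le_trans (cabs_sum _ _ _) _.
    by apply: ler_sum => b _; apply: step.
  under eq_bigr do rewrite sumr_const card_ord.
  by rewrite sumr_const card_ord -mulrnA -[leLHS]mulr_natr mulnC -mulrA -expr2.
apply: le_trans (hoelder_pushforward xi j t0) _.
rewrite card_prod !card_ord -natrX natrM natrM.
apply: ler_pM; first by rewrite mulr_ge0.
- by apply: sumr_ge0 => y _; rewrite exprn_ge0.
- rewrite ler_wpM2l // ler_nat.
  set E := [set q | _].
  (* A collision is a congruence [n a' = a n'] modulo [p ^ 2], and [A * N < p ^ 2] makes it an
     equality of integers. *)
  have hE q : q \in E -> (q.1.2.+1 * q.2.1.+1 = q.1.1.+1 * q.2.2.+1)%N.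
    rewrite inE => /eqP exi.
    have ex : x q.1 = x q.2 by rewrite -!xiE exi.
    have hlt (a : 'I_A) (n : 'I_N) : (a.+1 * n.+1 < p ^ 2)%N.
      by apply: leq_ltn_trans ANp; apply: leq_mul.
    have : (q.1.2.+1 * q.2.1.+1 = q.1.1.+1 * q.2.2.+1 %[mod p ^ 2])%N.
      rewrite -modnMml -(hx q.1) modnMml ex -mulnA [(x _ * _)%N]mulnC.
      by rewrite -modnMmr (hx q.2) modnMmr.
    by rewrite !modn_small // mulnC.
  pose F := [set w : ('I_A * 'I_N) * ('I_N * 'I_A) |
     (w.2.1.+1 * w.2.2.+1 == w.1.1.+1 * w.1.2.+1)%N].
  (* Regrouped as [((a, n'), (n, a'))], the second pair is a factorization of [a n'], so the divisor
     bound [D] counts its choices. *)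
  pose sw (q : ('I_A * 'I_N) * ('I_A * 'I_N)) :=
    ((q.1.1, q.2.2), (q.1.2, q.2.1)).
  have sw_inj : injective sw.
    by move=> [[? ?] [? ?]] [[? ?] [? ?]] [-> -> -> ->].
  rewrite -(card_imset _ sw_inj).
  apply: leq_trans (_ : #|F| <= _)%N.
    apply: subset_leq_card; apply/fintype.subsetP => w /imsetP[q /hE h ->].
    by rewrite inE /= h.
  rewrite -sum1_card (partition_big fst predT) //=.
  apply: leq_trans (_ : \sum_(w : 'I_A * 'I_N) D <= _)%N; last first.
    by rewrite sum_nat_const card_prod !card_ord.
  apply: leq_sum => w _; set m := (w.1.+1 * w.2.+1)%N.
  have m0 : (0 < m <= A * N)%N by rewrite muln_gt0 leq_mul.
  apply: leq_trans (hD m m0); rewrite sum1dep_card.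
  pose f (v : ('I_A * 'I_N) * ('I_N * 'I_A)) := v.2.1.+1.
  rewrite cardE -(size_map f); apply: uniq_leq_size.
    rewrite map_inj_in_uniq ?enum_uniq // => v v'.
    rewrite !mem_enum !inE => /andP[/eqP h1 /eqP h2] /andP[/eqP h3 /eqP h4] e.
    have e1 : v.2.1 = v'.2.1 by apply/val_inj/succn_inj.
    have e2 : v.2.2 = v'.2.2.
      apply/val_inj/succn_inj/eqP; rewrite -(@eqn_pmul2l v.2.1.+1) //.
      by rewrite {2}e1 h1 h3 h2 h4.
    case: v v' h2 h4 e1 e2 {h1 h3 e} => [v1 [v2 v3]] [v1' [v2' v3']] /=.
    by move=> -> -> -> ->.
  move=> d /mapP[v]; rewrite mem_enum !inE => /andP[/eqP h1 /eqP h2] ->.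
  rewrite -dvdn_divisors; last by case/andP: m0.
  by rewrite /m -h2 -h1 dvdn_mulr.
exact: short_sum_moment.
Qed.

End Burgess.

Section BurgessBound.
Variable R : realType.
Local Notation C := (complex R).
Local Notation cabs := (@Normc.normc R).

Lemma exprD_le2 (x y : R) n : 0 <= x -> 0 <= y ->
  (x + y) ^+ n <= 2 ^+ n * (x ^+ n + y ^+ n).
Proof.
move=> x0 y0; wlog xy : x y x0 y0 / x <= y.
  move=> H; have [|/ltW] := leP x y; first exact: H.
  by move=> yx; rewrite addrC [x ^+ n + _]addrC; apply: H.
apply: le_trans (_ : (2 * y) ^+ n <= _).
  by rewrite lerXn2r ?nnegrE ?addr_ge0 ?mulr_ge0 // mulr_natl mulr2n lerD2r.
by rewrite exprMn ler_pM2l ?exprn_gt0 // lerDr exprn_ge0.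
Qed.

(* Burgess's method with moment [2r = 2K], [B = P] and [A = P^h]. *)
Lemma burgess (j h : nat) : (2 ^ j = h.*2)%N -> (3 < h)%N ->
  exists2 c : R, 1 <= c & forall (P p : nat) (om : C) (l : 'F_p),
    (1 < P)%N -> prime p -> (P ^ (2 ^ j) <= p <= 2 ^ (2 ^ j) * P ^ (2 ^ j))%N ->
    om ^+ p = 1 -> om != 1 -> l != 0 ->
    (cabs (\sum_(n < P ^ (h + 2)) psi om l n.+1) / (P ^ (h + 2))%:R)
      ^+ (2 * 2 ^ j) <= c / P%:R.
Proof.
move=> jh h3.
have [//||Cd [Cd0 hCd]] := @ndiv_exp_le_root 1 (2 ^ j + 2); first by rewrite addn2.
set K := (2 ^ j)%N in jh hCd *.
have K0 : (0 < K)%N by rewrite expn_gt0.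
(* The moment bound with [B = P] and [p] replaced by [2 ^ K * P ^ K] is [c' * P ^ (3 * K)]. *)
pose c' := (2 ^ K * (K ^ K * 2 ^ K + 2 * K))%N.
pose c'' := (Cd * c')%N.
exists (4 ^+ K * (c''%:R + 4 ^+ K)).
  have h4 : 1 <= 4 ^+ K :> R by rewrite exprn_ege1 // ler1n.
  rewrite -[leLHS]mulr1; apply: ler_pM => //.
  by apply: le_trans h4 _; rewrite lerDr.
move=> P p om l P1 p_pr /andP[Pp pP] om_p om1 l0.
have P0 : (0 < P)%N by lia.
have P0R : 0 < P%:R :> R by rewrite ltr0n.
set A := (P ^ h)%N; set N := (P ^ (h + 2))%N.
have A0 : (0 < A)%N by rewrite expn_gt0 P0.
have N0 : (0 < N)%N by rewrite expn_gt0 P0.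
have AB : (A * P = P ^ h.+1)%N by rewrite expnSr.
have AN : (A * N = P ^ (K + 2))%N by rewrite -expnD jh; congr expn; lia.
have ABP : (A * P * P = N)%N by rewrite AB -expnSr; congr expn; lia.
(* The left side is at most [P ^ (h + 3)], which is below [P ^ K] because [K = 2 h] and [h > 3]. *)
have NAB : (N + A * P < p)%N.
  apply: leq_trans Pp; apply: leq_trans (_ : P ^ (h + 3) < _)%N; last first.
    by rewrite ltn_exp2l // jh; lia.
  rewrite ltnS addnS expnS; apply: leq_trans (_ : 2 * N <= _)%N.
    by rewrite mul2n -addnn leq_add2l -ABP leq_pmulr.
  by rewrite leq_mul2r P1 orbT.
have AN2 : (A * N < p ^ 2)%N.
  rewrite AN; apply: leq_trans (_ : P ^ (K * 2) <= _)%N.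
    by rewrite ltn_exp2l //; lia.
  by rewrite expnM leq_exp2r.
have Kp : (K < p)%N.
  apply: leq_trans Pp; apply: leq_trans (ltn_expl K (ltnSn 1)) _.
  by rewrite leq_exp2r.
have hD x : (0 < x <= A * N)%N -> (ndiv x <= Cd * P)%N.
  move=> /andP[x0 xAN]; rewrite -[ndiv x]expn1; apply: hCd => //.
  by rewrite -AN.
have [Z [Z0 hs hZ]] :=
  burgess_shift p_pr om_p om1 l0 A0 P0 NAB AN2 Kp hD.
rewrite -/K in hZ.
set s := cabs _ in hs *.
have s0 : 0 <= s by apply: cabs_ge0.
have AP0 : 0 < (A * P)%:R :> R by rewrite ltr0n muln_gt0 A0.
have N0R : 0 < N%:R :> R by rewrite ltr0n.
have NE : N%:R = (A * P)%:R * P%:R :> R by rewrite -natrM ABP.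
(* The saving of one factor [P] over the trivial bound. Multiplying [hZ] by [A * N = P ^ (K + 2)]
   completes the power [(A * N) ^ (2 * K)], after which [P ^ K.+1] cancels. *)
have hZ2 : Z ^+ (2 * K) * P%:R <= c''%:R * ((A * P)%:R * N%:R) ^+ (2 * K).
  have : Z ^+ (2 * K) * (A * N)%:R <=
      ((A * N) ^ (2 * K) * (Cd * P) * (c' * P ^ (3 * K)))%:R.
    apply: le_trans (ler_wpM2r _ hZ) _ => //.
    rewrite -natrM ler_nat.
    have -> : ((A * N) ^ (2 * K) = (A * N) ^ (2 * K.-1) * (A * N) * (A * N))%N.
      have -> : (2 * K = 2 * K.-1 + 2)%N.
        by rewrite -[in LHS](prednK K0) mulnS addnC.
      by rewrite expnD -mulnA mulnn.
    set Y := ((A * N) ^ (2 * K.-1))%N.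
    set V := (p * _)%N.
    have hV : (V <= c' * P ^ (3 * K))%N.
      have -> : (c' * P ^ (3 * K) = 2 ^ K * P ^ K *
          (P ^ K * K ^ K * (2 ^ K * P ^ K) + P ^ K * P ^ K * (2 * K)))%N.
        have -> : (3 * K = K + K + K)%N by ring.
        by rewrite !expnD /c'; ring.
      by apply: leq_mul => //; rewrite leq_add2r leq_mul2l pP orbT.
    have -> : (Y * (A * N * (Cd * P)) * V * (A * N) =
       Y * (A * N) * (A * N) * (Cd * P) * V)%N by ring.
    by rewrite leq_mul2l hV orbT.
  have PK0 : 0 < P%:R ^+ K.+1 :> R by rewrite exprn_gt0.
  have -> : (A * N)%:R = P%:R * P%:R ^+ K.+1 :> R.
    by rewrite AN natrX -exprS addn2.
  have -> : ((A * N) ^ (2 * K) * (Cd * P) * (c' * P ^ (3 * K)))%:R =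
      c''%:R * ((A * P)%:R * N%:R) ^+ (2 * K) * P%:R ^+ K.+1 :> R.
    rewrite /c'' !(natrM, natrX) !exprMn.
    have -> : (3 * K = 2 * K + K)%N by ring.
    by rewrite [_ ^+ (2 * K + K)]exprD [_ ^+ K.+1]exprS; ring.
  by rewrite mulrA ler_pM2r.
have hs2 : s / N%:R <= Z / ((A * P)%:R * N%:R) + 2 / P%:R.
  rewrite ler_pdivrMr // mulrDl.
  have -> : Z / ((A * P)%:R * N%:R) * N%:R = Z / (A * P)%:R.
    by rewrite invfM mulrA divfK // lt0r_neq0.
  have -> : 2 / P%:R * N%:R = 2 * (A * P)%:R :> R.
    by rewrite NE mulrA mulrAC divfK // lt0r_neq0.
  rewrite -(ler_pM2l AP0) mulrDr.
  have -> : (A * P)%:R * (Z / (A * P)%:R) = Z.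
    by rewrite mulrC divfK // lt0r_neq0.
  by apply: le_trans hs _; rewrite lerD2l expr2 mulrCA.
set z := Z / _ in hs2; have z0 : 0 <= z by rewrite divr_ge0 // mulr_ge0.
apply: le_trans (_ : (z + 2 / P%:R) ^+ (2 * K) <= _).
  by rewrite lerXn2r ?nnegrE ?divr_ge0 ?addr_ge0 ?divr_ge0.
apply: le_trans (exprD_le2 _ z0 _) _; first by rewrite divr_ge0.
have e4 : 2 ^+ (2 * K) = 4 ^+ K :> R by rewrite exprM; congr (_ ^+ _); ring.
have h4 : 0 < 4 ^+ K :> R by rewrite exprn_gt0 // ltr0n.
rewrite e4 -[leRHS]mulrA (ler_pM2l h4) [leRHS]mulrDl; apply: lerD.
  rewrite /z expr_div_n ler_pdivrMr ?exprn_gt0 ?mulr_gt0 //.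
  by rewrite mulrAC ler_pdivlMr.
rewrite expr_div_n e4 ler_wpM2l ?exprn_ge0 // lef_pV2 ?posrE ?exprn_gt0 //.
by rewrite -[leLHS]expr1 ler_weXn2l ?ler1n // muln_gt0 K0.
Qed.

End BurgessBound.

(** * Weighted count of products: Fourier transform and variance *)

Section ProductCount.
Variable R : realType.
Local Notation C := (complex R).
Local Notation cabs := (@Normc.normc R).
Variables (p : nat) (p_pr : prime p) (om : C).
Hypotheses (om_p : om ^+ p = 1) (om_neq1 : om != 1).
Variables (N1 N2 P k : nat) (e : nat -> R).
Hypotheses (N1p : (N1 < p)%N) (N2p : (N2 < p)%N) (Pp : (P < p)%N).
Hypothesis e1 : forall n, `|e n| <= 1.
Local Notation T := ('I_N1 * 'I_N2 * {ffun 'I_k -> 'I_P})%type.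

Definition tprod (t : T) : nat := (t.1.1.+1 * t.1.2.+1 * \prod_i (t.2 i).+1)%N.

Lemma coprime_succ_ord M (i : 'I_M) : (M < p)%N -> coprime i.+1 p.
Proof. by move=> Mp; apply: lt_coprime => //=; apply: leq_ltn_trans Mp. Qed.

Lemma tprod_coprime t : coprime (tprod t) p.
Proof.
rewrite /tprod !coprimeMl !coprime_succ_ord //=.
by apply: (big_ind (fun y => coprime y p)) => [|x y cx cy|i _];
  rewrite ?coprime1n ?coprimeMl ?cx ?coprime_succ_ord.
Qed.

Lemma tprod_le t : (0 < tprod t <= N1 * N2 * P ^ k)%N.
Proof.
apply/andP; split; first by rewrite !muln_gt0 prodn_gt0.
rewrite /tprod !leq_mul //.
apply: leq_trans (_ : \prod_(i < k) P <= _)%N; first exact: leq_prod.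
by rewrite prod_nat_const card_ord.
Qed.

Definition csum (M : nat) (f : nat -> R) (l : 'F_p) : C :=
  \sum_(n < M) (f n.+1)%:C%C * psi om l n.+1.

Lemma tsum_factor l :
  \sum_(t : T) (e t.1.1.+1)%:C%C * chi om (l * fq p (tprod t)) =
  csum N1 e l * csum N2 (fun=> 1) l * csum P (fun=> 1) l ^+ k.
Proof.
have -> : csum P (fun=> 1) l ^+ k = \prod_(i < k) csum P (fun=> 1) l.
  by rewrite prodr_const card_ord.
rewrite bigA_distr_bigA /= /csum.
rewrite big_distrlr pair_bigA /= big_distrlr pair_bigA /=; apply: eq_bigr => -[[n1 n2] v] _ /=.
rewrite /tprod /= !(fqM p_pr) ?coprimeMl ?coprime_succ_ord //; last first.
  by apply: (big_ind (fun y => coprime y p)) => [|x y cx cy|i _];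
    rewrite ?coprime1n ?coprimeMl ?cx ?coprime_succ_ord.
rewrite (fq_prod p_pr) => [|i]; last exact: coprime_succ_ord.
rewrite !mulrDr mulr_sumr !(chiD p_pr om_p) (chi_sum p_pr om_p).
rewrite /psi !coprime_succ_ord //.
under [in RHS]eq_bigr do rewrite coprime_succ_ord // mul1r.
by rewrite mul1r; ring.
Qed.

(** Each of the [k + 2] coordinates of [t], shifted by 1, is a divisor of [y]. *)
Lemma tprod_multiplicity y :
  (#|[set t | tprod t == y]| <= if 0 < y <= N1 * N2 * P ^ k then
     ndiv y ^ (k + 2) else 0)%N.
Proof.
case: ifP => hy; last first.
  rewrite leqn0 cards_eq0; apply/eqP/setP => t; rewrite !inE.
  by apply/negP => /eqP ty; rewrite -ty tprod_le in hy.
case/andP: hy => y0 _.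
pose Dv M := [set i : 'I_M | (i.+1 %| y)%N].
have cD M : (#|Dv M| <= ndiv y)%N.
  rewrite cardE -(size_map (fun i : 'I_M => i.+1)); apply: uniq_leq_size.
    by rewrite map_inj_uniq ?enum_uniq // => i i' /succn_inj/val_inj.
  by move=> d /mapP[n]; rewrite mem_enum inE => dn ->; rewrite -dvdn_divisors.
pose V := [set f : {ffun 'I_k -> 'I_P} | f \in ffun_on (mem (Dv P))].
have cV : (#|V| <= ndiv y ^ k)%N.
  rewrite cardsE card_ffun_on card_ord.
  by case: (k) => [|k']; rewrite ?expn0 // leq_exp2r.
apply: leq_trans (_ : #|finset.setX (finset.setX (Dv N1) (Dv N2)) V| <= _)%N.
  apply: subset_leq_card; apply/fintype.subsetP => -[[n1 n2] v].
  rewrite !inE /tprod /= => /eqP ty.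
  have -> : (n1.+1 %| y)%N by rewrite -ty -!mulnA dvdn_mulr.
  have -> : (n2.+1 %| y)%N by rewrite -ty -!mulnA mulnCA dvdn_mulr.
  apply/forallP => i; rewrite /= inE -ty dvdn_mull //.
  by rewrite (bigD1 i) //= dvdn_mulr.
rewrite !cardsX addn2 !expnS mulnA mulnC.
apply: leq_trans (leq_mul cV (leq_mul (cD N1) (cD N2))) _.
by rewrite mulnC.
Qed.

Lemma tsum_large_sieve (D : nat) :
  (forall y, 0 < y <= N1 * N2 * P ^ k -> ndiv y ^ (k + 2) <= D)%N ->
  \sum_l cabs (csum N1 e l * csum N2 (fun=> 1) l * csum P (fun=> 1) l ^+ k) ^+ 2
  <= (N1 * N2 * P ^ k * D * (N1 * N2 * P ^ k + p ^ 2))%:R.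
Proof.
move=> hD.
have -> : (N1 * N2 * P ^ k = #|{: T}|)%N.
  by rewrite !card_prod card_ffun !card_ord.
under eq_bigr do rewrite -tsum_factor.
apply: (large_sieve p_pr om_p om_neq1).
- by move=> t; rewrite cabs_real.
- exact: tprod_coprime.
- by move=> t; rewrite !card_prod card_ffun !card_ord; case/andP: (tprod_le t).
move=> y; apply: leq_trans (tprod_multiplicity y) _.
by case: ifP => // /hD.
Qed.

Lemma cabs_csum_le M f l : (forall n, `|f n| <= 1) -> cabs (csum M f l) <= M%:R.
Proof.
move=> hf; apply: le_trans (cabs_sum _ _ _) _.
rewrite -[in leRHS](card_ord M) -sum1_card natr_sum; apply: ler_sum => n _.
rewrite Normc.normcM cabs_real mulr_ile1 ?cabs_ge0 //.
exact: (cabs_psi p_pr om_p).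
Qed.

Lemma csum_cst1 M l : csum M (fun=> 1) l = \sum_(n < M) psi om l n.+1.
Proof. by apply: eq_bigr => n _; rewrite mul1r. Qed.

(* By Parseval the sum over [l != 0] is [p] times the variance of [hh]. *)
Lemma variance_bound (E : {set 'F_p}) :
  let hh s := \sum_(t : T | fq p (tprod t) == s) e t.1.1.+1 in
  let tot := \sum_(t : T) e t.1.1.+1 in
  0 <= tot -> (forall s, s \in E -> hh s <= 0) ->
  #|E|%:R * tot ^+ 2 <= p%:R * \sum_(l | l != 0)
    cabs (csum N1 e l * csum N2 (fun=> 1) l * csum P (fun=> 1) l ^+ k) ^+ 2.
Proof.
move=> hh tot tot0 hE.
have p0 : 0 < p%:R :> R by rewrite ltr0n prime_gt0.
pose H l := \sum_s (hh s)%:C%C * chi om (l * s).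
have HE l : csum N1 e l * csum N2 (fun=> 1) l * csum P (fun=> 1) l ^+ k = H l.
  rewrite -tsum_factor (partition_big (fun t => fq p (tprod t)) predT) //=.
  apply: eq_bigr => s _; rewrite /hh rmorph_sum mulr_suml.
  by apply: eq_bigr => t /eqP ->.
have hhs : \sum_s hh s = tot.
  by rewrite /tot (partition_big (fun t => fq p (tprod t)) predT).
have H0 : cabs (H 0) = tot.
  rewrite /H (eq_bigr (fun s => (hh s)%:C%C)) => [|s _]; last first.
    by rewrite mul0r (chi0 p_pr om_p) mulr1.
  have -> : \sum_s (hh s)%:C%C = tot%:C%C.
    by rewrite -hhs (rmorph_sum (real_complex R)).
  by rewrite cabs_real ger0_norm.
have pars : \sum_l cabs (H l) ^+ 2 = p%:R * \sum_s cabs (hh s)%:C%C ^+ 2.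
  exact: (parseval p_pr om_p om_neq1 (fun s => (hh s)%:C%C)).
have hh2 : \sum_s cabs (hh s)%:C%C ^+ 2 = \sum_s hh s ^+ 2.
  by apply: eq_bigr => s _; rewrite cabs_real real_normK // num_real.
rewrite (bigD1 0) // H0 hh2 in pars.
under eq_bigr do rewrite HE.
have -> : \sum_(l | l != 0) cabs (H l) ^+ 2 =
    p%:R * \sum_s hh s ^+ 2 - tot ^+ 2.
  by rewrite -pars addrAC subrr add0r.
(* The mean of [hh]. On [E] it is missed by at least [m], so each element of [E] adds at least
   [m ^ 2] to the variance, as in Chebyshev's inequality. *)
pose m := tot / p%:R; have m0 : 0 <= m by rewrite divr_ge0 // ltW.
have mE : tot = p%:R * m by rewrite /m mulrCA divff ?mulr1 // lt0r_neq0.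
have v : \sum_s (hh s - m) ^+ 2 = \sum_s hh s ^+ 2 - p%:R * m ^+ 2.
  transitivity (\sum_s (hh s ^+ 2 - 2 * m * hh s + m ^+ 2)).
    by apply: eq_bigr => s _; ring.
  rewrite big_split sumrB /= -mulr_sumr hhs sumr_const card_Fp // mE.
  rewrite -[m ^+ 2 *+ p]mulr_natl; ring.
have low : #|E|%:R * m ^+ 2 <= \sum_s (hh s - m) ^+ 2.
  rewrite mulr_natl -sumr_const [leRHS](bigID (mem E)) /=.
  apply: le_trans (_ : \sum_(s in E) (hh s - m) ^+ 2 <= _).
    apply: ler_sum => s sE; rewrite -[leRHS]sqrrN lerXn2r ?nnegrE //.
      by rewrite opprB subr_ge0 (le_trans (hE s sE)).
    by rewrite opprB lerDl oppr_ge0 hE.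
  by rewrite lerDl sumr_ge0 // => s _; rewrite sqr_ge0.
rewrite v in low.
have -> : #|E|%:R * tot ^+ 2 = p%:R ^+ 2 * (#|E|%:R * m ^+ 2).
  by rewrite mE; ring.
have -> : p%:R * (p%:R * \sum_s hh s ^+ 2 - tot ^+ 2) =
    p%:R ^+ 2 * (\sum_s hh s ^+ 2 - p%:R * m ^+ 2) by rewrite mE; ring.
by rewrite ler_wpM2l // exprn_ge0 // ltW.
Qed.

End ProductCount.

Section SpectralBound.
Variable R : realType.

(* Where [w < rho] one factor [w] already saves; where [w >= rho], [w^(4K)]
   counts the exceptions and [s] saves. *)
Lemma spectral_bound (L : finType) (l0 : L) (g s w : L -> R) (K k : nat)
    (rho c1 c2 : R) :
  (forall l, 0 <= g l <= 1) -> (forall l, 0 <= s l <= 1) ->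
  (forall l, 0 <= w l <= 1) -> (0 < K)%N -> 0 < rho <= 1 -> 1 <= c1 ->
  (forall l, l != l0 -> s l ^+ (2 * K) <= c1 * rho ^+ (16 * K * K)) ->
  \sum_l w l ^+ (4 * K) <= c2 / rho ->
  \sum_l (g l * s l * w l ^+ k) ^+ 2 <= c2 / rho ->
  \sum_(l | l != l0) (g l * s l * w l ^+ k.+1) ^+ 2 <= (1 + c1) * c2 * rho.
Proof.
move=> hg hs hw K0 /andP[r0 r1] c11 hS hW hG.
have c10 : 0 <= c1 by lra.
(* The [K]-th root of the bound on [s] is [s ^ 2 <= c1 * rho ^ (16 K)]; it leaves [rho ^ 2] after
   paying [rho ^ (4 K) <= w ^ (4 K)]. *)
have hK : (2 + 4 * K <= 16 * K)%N by move: K0; clear; lia.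
have rw0 : 0 <= rho by exact: ltW.
have s2 l : l != l0 -> s l ^+ 2 <= c1 * rho ^+ (16 * K).
  move=> ll0; have /andP[s0 _] := hs l.
  rewrite -(ler_pXn2r K0) ?nnegrE ?mulr_ge0 ?exprn_ge0 //.
  rewrite -exprM; apply: le_trans (hS l ll0) _.
  rewrite exprMn -exprM ler_wpM2r ?exprn_ge0 //.
  by rewrite -[leLHS]expr1 ler_weXn2l.
have gs1 l : 0 <= g l * s l <= 1.
  have /andP[g0 g1] := hg l; have /andP[s0 s1] := hs l.
  by rewrite mulr_ge0 //= mulr_ile1.
have wk l m : 0 <= w l ^+ m <= 1.
  have /andP[w0 w1] := hw l; by rewrite exprn_ge0 //= exprn_ile1.
have term l : l != l0 -> (g l * s l * w l ^+ k.+1) ^+ 2 <=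
    rho ^+ 2 * (g l * s l * w l ^+ k) ^+ 2 + c1 * rho ^+ 2 * w l ^+ (4 * K).
  move=> ll0; have /andP[w0 w1] := hw l.
  have c1t : 0 <= c1 * rho ^+ 2 * w l ^+ (4 * K).
    by rewrite !mulr_ge0 ?exprn_ge0.
  have [wr|rw] := ltP (w l) rho.
    apply: le_trans (_ : rho ^+ 2 * (g l * s l * w l ^+ k) ^+ 2 <= _); last first.
      by rewrite lerDl.
    have -> : g l * s l * w l ^+ k.+1 = w l * (g l * s l * w l ^+ k).
      by rewrite exprS; ring.
    rewrite exprMn ler_wpM2r ?sqr_ge0 // lerXn2r ?nnegrE //; exact: ltW.
  apply: le_trans (_ : s l ^+ 2 <= _).
    have /andP[g0 g1] := hg l; have /andP[s0 s1] := hs l.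
    have /andP[u0 u1] := wk l k.+1.
    rewrite lerXn2r ?nnegrE ?mulr_ge0 // -[leRHS]mulr1.
    rewrite ler_pM ?mulr_ge0 // -[leRHS]mul1r ler_wpM2r //.
  apply: le_trans (s2 l ll0) _.
  apply: le_trans (_ : c1 * rho ^+ 2 * rho ^+ (4 * K) <= _); last first.
    apply: le_trans (_ : c1 * rho ^+ 2 * w l ^+ (4 * K) <= _); last first.
      by rewrite lerDr mulr_ge0 ?sqr_ge0.
    rewrite ler_wpM2l ?mulr_ge0 ?exprn_ge0 // lerXn2r ?nnegrE //.
  by rewrite -mulrA -exprD ler_wpM2l // ler_wiXn2l.
apply: le_trans (ler_sum _ term) _.
rewrite big_split /= -!mulr_sumr.
have sub (F : L -> R) : (forall l, 0 <= F l) -> \sum_(l | l != l0) F l <= \sum_l F l.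
  by move=> F0; rewrite [leRHS](bigD1 l0) //= lerDr.
have e : (1 + c1) * c2 * rho = rho ^+ 2 * (c2 / rho) + c1 * rho ^+ 2 * (c2 / rho).
  by field; rewrite lt0r_neq0.
rewrite e; apply: lerD.
  rewrite ler_wpM2l ?sqr_ge0 //; apply: le_trans hG.
  by apply: sub => l; apply: sqr_ge0.
rewrite ler_wpM2l ?mulr_ge0 ?sqr_ge0 //; apply: le_trans hW.
by apply: sub => l; case/andP: (wk l (4 * K)%N).
Qed.

End SpectralBound.

(** * Almost all residues *)

Section AlmostAllResidues.
Variable R : realType.
Local Notation C := (complex R).
Local Notation cabs := (@Normc.normc R).

Definition sgn_smooth (U n : nat) : R := if smooth U n then 1 else -1.

Lemma sum_sgn_smooth (U N : nat) :
  \sum_(n < N) sgn_smooth U n.+1 =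
  2 * #|[set n : 'I_N | smooth U n.+1]|%:R - N%:R.
Proof.
transitivity (\sum_(n < N) (2 * (smooth U n.+1)%:R - 1 : R)).
  by apply: eq_bigr => n _; rewrite /sgn_smooth; case: smooth; rewrite /=; ring.
rewrite sumrB sumr_const card_ord -mulr_sumr; congr (2 * _ - _).
rewrite -sum1_card natr_sum [RHS]big_mkcond /=.
by apply: eq_bigr => n _; rewrite inE; case: smooth.
Qed.

(* [1_A 1_B >= 1_A + 1_B - 1] symmetrized: [sgn (n1) + sgn (n2) <= 0] unless
   both [n1] and [n2] are smooth. *)
Lemma sgn_count_le0 p (N P k U : nat) (s : 'F_p) :
  (forall t : 'I_N * 'I_N * {ffun 'I_k -> 'I_P}, fq p (tprod t) == s ->
     ~~ (smooth U t.1.1.+1 && smooth U t.1.2.+1)) ->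
  \sum_(t : 'I_N * 'I_N * {ffun 'I_k -> 'I_P} | fq p (tprod t) == s)
    sgn_smooth U t.1.1.+1 <= 0.
Proof.
move=> h; set S := \sum_(t | _) _.
pose sw (t : 'I_N * 'I_N * {ffun 'I_k -> 'I_P}) := ((t.1.2, t.1.1), t.2).
have swK : involutive sw by case=> [[? ?] ?].
have e : S = \sum_(t : 'I_N * 'I_N * {ffun 'I_k -> 'I_P} |
    fq p (tprod t) == s) sgn_smooth U t.1.2.+1.
  rewrite /S (reindex_inj (can_inj swK)) /=; apply: eq_bigl => t.
  by congr (fq p _ == s); rewrite /tprod /= [(_.+1 * _.+1)%N]mulnC.
have : S + S <= 0.
  rewrite {2}e -big_split /=; apply: sumr_le0 => t /h.
  by rewrite /sgn_smooth; case: smooth; case: smooth => //= _; lra.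
lra.
Qed.

(** With [N = P ^ (h + 2)], smoothness bound [P ^ b] and [K = 2 ^ j], the two inequalities on [b]
    say [N <= (P ^ b) ^ 2] and, for [k = K - 4], [N ^ 2 * P ^ (k.+1 + 7) <= (P ^ b) ^ 7], as
    [seven_factors] requires. *)
Lemma exceptions_small (j h b : nat) (c0 : R) : (2 ^ j = h.*2)%N -> (3 < h)%N ->
  (h + 2 <= 2 * b)%N -> (2 * 2 ^ j + 8 <= 7 * b)%N -> 0 < c0 ->
  exists2 c : R, 0 < c & forall P p : nat, (1 < P)%N -> prime p ->
    (P ^ (2 ^ j) <= p <= 2 ^ (2 ^ j) * P ^ (2 ^ j))%N ->
    (2^-1 + c0) * (P ^ (h + 2))%:R <=
      #|[set i : 'I_(P ^ (h + 2)) | smooth (P ^ b) i.+1]|%:R ->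
    forall U : R, (P ^ b)%:R <= U ->
    #|fq_exceptions p U 7|%:R <=
      c * P%:R `^ (- (16 * 2 ^ j * 2 ^ j)%:R^-1) * p%:R.
Proof.
move=> jh h3 hb7 hb c00.
have [cb cb1 hburg] := burgess R jh h3.
set K := (2 ^ j)%N in jh hb hburg *; clearbody K.
(* This makes [N * N * P ^ k = P ^ (2 K)], of the order of [p ^ 2], where the large sieve loses only
   a divisor factor. The products counted have one factor more. *)
pose k := (K - 4)%N.
have [K0 hK k2] : [/\ (0 < K)%N, (h + 2 < K)%N & (k + 2 <= 2 * K + 2)%N].
  by rewrite /k jh; clear - h3; split; lia.
have [k3 k4] : (h + 2 + (h + 2) + k = 2 * K)%N /\
    ((h + 2) * 2 + (k.+1 + 7) <= b * 7)%N.
  by rewrite /k; clear - jh h3 hb; split; lia.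
have hb' : (h + 2 <= b * 2)%N by rewrite mulnC.
clearbody k.
(* Multiplicities are at most [ndiv y ^ (2 K + 2)]; the extra exponent [16 K K] makes this at most
   [Cd / rho], since [rho ^ (16 K K) = 1 / P]. *)
have [||Cd [Cd0 hCd]] := @ndiv_exp_le_root ((2 * K + 2) * (16 * K * K)) (2 * K).
- by rewrite muln_gt0 addn2 !muln_gt0 K0.
- by rewrite muln_gt0 K0.
pose c2 : R := Cd%:R * (1 + 4 ^+ K).
have c20 : 0 < c2 by rewrite mulr_gt0 ?ltr0n // ltr_pwDl // exprn_ge0.
pose cc := (1 + cb) * c2 / (2 * c0) ^+ 2.
have cc0 : 0 < cc.
  have cb0 : 0 < 1 + cb by lra.
  by apply: divr_gt0; [exact: mulr_gt0 | rewrite exprn_gt0 // mulr_gt0].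
exists cc => // P p P1 p_pr pP smoothN U PU.
have [om om_p om1] := exists_root_of_unity R p_pr.
set rho := P%:R `^ _.
have P0 : (0 < P)%N := ltnW P1.
have P0R : 0 < P%:R :> R by rewrite ltr0n.
have r0 : 0 < rho by apply: powR_gt0.
have rK : rho ^+ (16 * K * K) = P%:R^-1.
  rewrite /rho -powR_mulrn ?powR_ge0 // -powRrM mulNr mulVf ?powR_inv1 ?ler0n //.
  by rewrite pnatr_eq0 !muln_eq0 !negb_or -!lt0n K0.
have r1 : rho <= 1.
  have h16 : (0 < 16 * K * K)%N by rewrite !muln_gt0 K0.
  rewrite -(ler_pXn2r h16) ?nnegrE ?(ltW r0) // rK expr1n.
  by rewrite invf_le1 // ler1n.
set N := (P ^ (h + 2))%N in smoothN *.
have N0 : (0 < N)%N by rewrite expn_gt0 P0.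
have N0R : 0 < N%:R :> R by rewrite ltr0n.
have Np : (N < p)%N.
  by case/andP: pP => Pp _; apply: leq_trans Pp; rewrite ltn_exp2l.
have Pp : (P < p)%N.
  by apply: leq_ltn_trans Np; rewrite -[leqLHS]expn1 leq_exp2l // addn2.
pose X := (P ^ (2 * K))%N.
have XE : (N * N * P ^ k = X)%N.
  by rewrite /X -!expnD k3.
have X0R : 0 < X%:R :> R by rewrite ltr0n expn_gt0 P0.
have p2X : (p ^ 2)%:R <= 4 ^+ K * X%:R :> R.
  case/andP: pP => _ pP.
  apply: le_trans (_ : ((2 ^ K * P ^ K) ^ 2)%:R <= _).
    by rewrite ler_nat leq_exp2r.
  have e4 : 4 ^+ K = 2 ^+ (K * 2) :> R.
    by rewrite mulnC exprM; congr (_ ^+ _); ring.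
  by rewrite e4 /X (mulnC 2 K) natrX natrM exprMn !natrX -!exprM.
pose D := Num.truncn (Cd%:R / rho).
have DR : D%:R <= Cd%:R / rho by rewrite truncn_le // divr_ge0 // ltW.
have hD y m : (0 < y <= X)%N -> (m <= 2 * K + 2)%N -> (ndiv y ^ m <= D)%N.
  move=> /andP[y0 yX] mK.
  rewrite truncn_ge_nat ?divr_ge0 ?(ltW r0) //.
  have nd0 : (0 < ndiv y)%N.
    by rewrite /ndiv; have := divisor1 y; case: (divisors y).
  apply: le_trans (_ : (ndiv y ^ (2 * K + 2))%:R <= _).
    by rewrite ler_nat leq_pexp2l.
  rewrite ler_pdivlMr //.
  have h16 : (0 < 16 * K * K)%N by rewrite !muln_gt0 K0.
  rewrite -(ler_pXn2r h16) ?nnegrE ?mulr_ge0 ?(ltW r0) //.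
  rewrite exprMn rK -natrX -expnM.
  rewrite ler_pdivrMr //.
  apply: le_trans (_ : (Cd * P)%:R <= _); first by rewrite ler_nat hCd.
  rewrite natrM ler_pM2r // -natrX ler_nat.
  by rewrite -[leqLHS]expn1 leq_pexp2l.
pose e n : R := sgn_smooth (P ^ b) n.
have e1 n : `|e n| <= 1.
  by rewrite /e /sgn_smooth; case: smooth; rewrite ?normrN normr1.
pose one := (fun _ : nat => 1 : R).
have one1 n : `|one n| <= 1 by rewrite normr1.
pose g (l : 'F_p) := cabs (csum om N e l) / N%:R.
pose s (l : 'F_p) := cabs (csum om N one l) / N%:R.
pose w (l : 'F_p) := cabs (csum om P one l) / P%:R.
have norm01 M f (l : 'F_p) : (0 < M)%N -> (forall n, `|f n| <= 1) ->
    0 <= cabs (csum om M f l) / M%:R <= 1.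
  move=> M0 hf; rewrite divr_ge0 ?cabs_ge0 //= ler_pdivrMr ?ltr0n // mul1r.
  exact: (cabs_csum_le p_pr om_p).
have hS l : l != 0 -> s l ^+ (2 * K) <= cb * rho ^+ (16 * K * K).
  move=> l0; rewrite rK /s csum_cst1; exact: hburg.
have XDX (D0 : (0 <= D%:R :> R)) :
    (X * D * (X + p ^ 2))%:R <= X%:R ^+ 2 * (c2 / rho) :> R.
  rewrite natrM natrD natrM.
  apply: le_trans (_ : X%:R * (Cd%:R / rho) * (X%:R + 4 ^+ K * X%:R) <= _).
    by rewrite ler_pM ?mulr_ge0 ?addr_ge0 // ?ler_wpM2l // lerD2l.
  rewrite /c2; rewrite le_eqVlt; apply/orP; left; apply/eqP; ring.
(* Large sieve with trivial ranges for [n1] and [n2] and [2 K] factors up to [P], whose product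
   again has the order of [p ^ 2]. *)
have hW : \sum_l w l ^+ (4 * K) <= c2 / rho.
  have ls := @tsum_large_sieve R p p_pr om om_p om1 1 1 P (2 * K) one
    (prime_gt1 p_pr) (prime_gt1 p_pr) Pp one1 D.
  rewrite !mul1n -/X in ls.
  have {}ls := ls (fun y hy => hD y _ hy (leqnn _)).
  have csum11 (l : 'F_p) : cabs (csum om 1 one l) = 1.
    rewrite /csum big_ord_recl big_ord0 addr0 mul1r /psi coprime1n.
    by rewrite (cabs_chi p_pr om_p).
  have := le_trans ls (XDX (ler0n _ _)).
  rewrite -ler_pdivrMl ?exprn_gt0 // mulr_sumr; apply: le_trans.
  apply: ler_sum => l _; rewrite !Normc.normcM cabsX !csum11 !mul1r /w.
  by rewrite expr_div_n -exprM /X natrX -exprM mulrC (mulnC (2 * K)%N) mulnA.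
have hG : \sum_l (g l * s l * w l ^+ k) ^+ 2 <= c2 / rho.
  have ls := @tsum_large_sieve R p p_pr om om_p om1 N N P k e Np Np Pp e1 D.
  rewrite XE in ls.
  have {}ls := ls (fun y hy => hD y _ hy k2).
  have := le_trans ls (XDX (ler0n _ _)).
  rewrite -ler_pdivrMl ?exprn_gt0 // mulr_sumr; apply: le_trans.
  apply: ler_sum => l _; rewrite !Normc.normcM cabsX /g /s /w.
  rewrite -XE !natrM natrX; rewrite le_eqVlt; apply/orP; left; apply/eqP.
  by rewrite expr_div_n !mulf_div expr_div_n mulrC.
have spec := @spectral_bound R _ (0 : 'F_p) g s w K k rho cb c2
  (fun l => norm01 _ _ l N0 e1) (fun l => norm01 _ _ l N0 one1)
  (fun l => norm01 _ _ l P0 one1) K0 (introT andP (conj r0 r1)) cb1 hS hW hG.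
pose toF (a : 'I_p) : 'F_p := (a : nat)%:R.
pose E : {set 'F_p} := toF @: fq_exceptions p U 7.
have cardE : #|E| = #|fq_exceptions p U 7|.
  rewrite card_in_imset // => a a' _ _ /(Fp_eq_mod p_pr).
  by rewrite !modn_small // => /val_inj.
pose tot := \sum_(t : 'I_N * 'I_N * {ffun 'I_k.+1 -> 'I_P}) e t.1.1.+1.
have totE : tot = (2 * #|[set i : 'I_N | smooth (P ^ b) i.+1]|%:R - N%:R) *
    (N * P ^ k.+1)%:R.
  rewrite /tot -sum_sgn_smooth.
  rewrite -(pair_bigA _ (fun (a : 'I_N * 'I_N) (v : {ffun 'I_k.+1 -> 'I_P}) =>
    e a.1.+1)) /=.
  rewrite -(pair_bigA _ (fun (n1 n2 : 'I_N) =>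
    \sum_(v : {ffun 'I_k.+1 -> 'I_P}) e n1.+1)) /=.
  rewrite mulr_suml; apply: eq_bigr => n _.
  rewrite !sumr_const card_ffun !card_ord -mulrnA -[LHS]mulr_natr.
  by rewrite [(N * _)%N]mulnC.
(* The smooth majority gives the signed count of [n1] the surplus [2 (1/2 + c0) - 1 = 2 c0]. *)
have tot_ge : 2 * c0 * (N * N * P ^ k.+1)%:R <= tot.
  rewrite totE -mulnA natrM mulrA ler_wpM2r //; lra.
have tot0 : 0 <= tot by apply: le_trans tot_ge; rewrite !mulr_ge0 // ltW.
have vb := @variance_bound R p p_pr om om_p om1 N N P k.+1 e Np Np Pp E tot0.
(* A product in the class of an exception cannot have both [n1] and [n2] smooth, as its seven
   factors would represent the class. *)
have hE : forall z, z \in E ->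
    \sum_(t : 'I_N * 'I_N * {ffun 'I_k.+1 -> 'I_P} | fq p (tprod t) == z)
    e t.1.1.+1 <= 0.
  move=> z /imsetP[a]; rewrite inE => /andP[_ /asboolP nrep] ->.
  apply: sgn_count_le0 => t /eqP ft; apply/negP => /andP[s1 s2]; apply: nrep.
  have Pb0 : (0 < P ^ b)%N by rewrite expn_gt0 P0.
  have NPb : (N <= (P ^ b) ^ 2)%N by rewrite -expnM leq_exp2l.
  have NPk : (N ^ 2 * P ^ (k.+1 + 7) <= (P ^ b) ^ 7)%N.
    by rewrite -!expnM -expnD leq_exp2l.
  have [u [uU uE]] := seven_factors P0 Pb0 NPb (fun i => ltn_ord (t.2 i))
    (ltn_ord t.1.1 : (0 < t.1.1.+1 <= N)%N) (ltn_ord t.1.2 : (0 < t.1.2.+1 <= N)%N)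
    (elimT (smoothP _ (ltn0Sn _)) s1) (elimT (smoothP _ (ltn0Sn _)) s2) NPk.
  have cu i : coprime (u i) p.
    have := tprod_coprime p_pr Np Np Pp t; rewrite /tprod -uE.
    by rewrite (bigD1 i) //= coprimeMl => /andP[].
  apply: (fq_sum_representableP p_pr cu).
    by move=> i; apply: le_trans PU; rewrite ler_nat.
  by rewrite -(fq_prod p_pr) // uE; exact: ft.
have {}vb := vb hE; rewrite -/tot cardE in vb.
pose Y := (N * N * P ^ k.+1)%N.
have Y0 : 0 < Y%:R :> R by rewrite ltr0n !muln_gt0 N0 expn_gt0 P0.
have sE : \sum_(l : 'F_p | l != 0) cabs (csum om N e l * csum om N one l *
    csum om P one l ^+ k.+1) ^+ 2 =
    Y%:R ^+ 2 * \sum_(l : 'F_p | l != 0) (g l * s l * w l ^+ k.+1) ^+ 2.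
  rewrite mulr_sumr; apply: eq_bigr => l _.
  rewrite !Normc.normcM cabsX /g /s /w expr_div_n !mulf_div.
  have <- : Y%:R = N%:R * N%:R * P%:R ^+ k.+1 :> R.
    by rewrite /Y natrM natrM natrX.
  by rewrite expr_div_n [RHS]mulrC divfK // expf_neq0 // lt0r_neq0.
rewrite sE in vb.
have v2 : #|fq_exceptions p U 7|%:R * (2 * c0 * Y%:R) ^+ 2 <=
    p%:R * (Y%:R ^+ 2 * ((1 + cb) * c2 * rho)).
  apply: le_trans (_ : #|fq_exceptions p U 7|%:R * tot ^+ 2 <= _).
    rewrite ler_wpM2l // lerXn2r ?nnegrE // !mulr_ge0 // ltW //.
  apply: le_trans vb _; rewrite !ler_wpM2l // ?exprn_ge0 //.
have Q0 : 0 < (2 * c0 * Y%:R) ^+ 2 by rewrite exprn_gt0 // !mulr_gt0.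
rewrite -(ler_pM2r Q0); apply: le_trans v2 _.
rewrite /cc; rewrite le_eqVlt; apply/orP; left; apply/eqP; field; rewrite lt0r_neq0 //.
Qed.

End AlmostAllResidues.

(** * Choice of parameters and conclusion *)

Lemma exists_floor_root (K p : nat) : (0 < K)%N -> (0 < p)%N ->
  exists P, [/\ (0 < P)%N, (P ^ K <= p)%N & (p < P.+1 ^ K)%N].
Proof.
move=> K0; elim: p => [//|[|p] IH] _.
  by exists 1%N; rewrite exp1n; split=> //; rewrite -{1}(expn0 2) ltn_exp2l.
have [P [P0 h1 h2]] := IH isT.
have [h|h] := ltnP p.+2 (P.+1 ^ K); first by exists P; split=> //; apply: leqW.
by exists P.+1; split=> //; apply: leq_ltn_trans h2 _; rewrite ltn_exp2r.
Qed.

(** Exceeding [4 / 7] gives seven factors enough room; staying below [2 / 3] keeps the smoothness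
    exponent [b] under [h + 2]. The two sides use [(7 / 8) ^ 4] and [e ^ (1/2) >= 3 / 2]. *)
Lemma expR_half_bounds (R : realType) :
  4 / 7 + 1 / 100 <= expR (- 2^-1) :> R /\ expR (- 2^-1) <= 2 / 3 :> R.
Proof.
split.
  have h : 7 / 8 <= expR (- 8^-1) :> R.
    by apply: le_trans (expR_ge1Dx _); lra.
  have -> : - 2^-1 = 4%:R * (- 8^-1) :> R by lra.
  rewrite expRM_natl; apply: le_trans (_ : (7 / 8) ^+ 4 <= _); first by lra.
  by rewrite lerXn2r // nnegrE ?expR_ge0 //; lra.
have E1 : expR (- 2^-1) * expR (2^-1) = 1 :> R by rewrite -expRD addNr expR0.
have E2 : 3 / 2 <= expR (2^-1) :> R by apply: le_trans (expR_ge1Dx _); lra.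
have : expR (- 2^-1) * (3 / 2) <= expR (- 2^-1) * expR (2^-1) :> R.
  by rewrite ler_wpM2l ?expR_ge0.
by rewrite E1; lra.
Qed.

(** [b] is the integer part of the allowed exponent times [K = 2 h]. The condition [3 <= e * h]
    outweighs the rounding: [e ^ (1/2) (b - 1)] still exceeds [h + 1], which is the Mertens
    condition. *)
Lemma exponent_choice (R : realType) (e : R) (h : nat) :
  0 < e <= 1 / 100 -> (3 < h)%N -> 3 <= e * h%:R ->
  exists b : nat, [/\ (h + 2 <= 2 * b)%N, (2 * h.*2 + 8 <= 7 * b)%N,
    (1 < b <= h + 2)%N, ln (h + 2).-1%:R - ln b.-1%:R < 2^-1 :> R
    & b%:R <= (2^-1 * expR (- 2^-1) + e) * h.*2%:R].
Proof.
move=> /andP[e0 e1] h3 he.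
have [th1 th2] := expR_half_bounds R.
have E1 : expR (2^-1) * expR (- 2^-1) = 1 :> R by rewrite -expRD subrr expR0.
set th := expR (- _) in th1 th2 E1 *; clearbody th.
have hp0 : 0 < h%:R :> R by rewrite ltr0n; exact: leq_trans h3.
have KR : h.*2%:R = 2 * h%:R :> R by rewrite -muln2 natrM mulrC.
have th0 : 0 <= th by lra.
have tK0 : 0 <= (2^-1 * th + e) * h.*2%:R.
  by rewrite mulr_ge0 // addr_ge0 ?mulr_ge0 // ltW.
pose b := Num.truncn ((2^-1 * th + e) * h.*2%:R).
have b1 : b%:R <= (2^-1 * th + e) * h.*2%:R by rewrite truncn_le.
have b2 : (2^-1 * th + e) * h.*2%:R < b%:R + 1 by rewrite natr1 truncnS_gt.
clearbody b.
have thh1 : (4 / 7 + 1 / 100) * h%:R <= th * h%:R by rewrite ler_pM2r.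
have thh2 : th * h%:R <= 2 / 3 * h%:R by rewrite ler_pM2r.
have ehh : e * h%:R <= 1 / 100 * h%:R by rewrite ler_pM2r.
have b1' : b%:R <= th * h%:R + 2 * (e * h%:R) by rewrite KR in b1; lra.
have b2' : th * h%:R + 2 * (e * h%:R) < b%:R + 1 by rewrite KR in b2; lra.
have b3 : (2 <= b)%N by rewrite -(ler_nat R); lra.
exists b; split=> //.
- by rewrite -(ler_nat R) natrD natrM; lra.
- by rewrite -(ler_nat R) natrD !natrM KR; lra.
- by rewrite b3 -(ler_nat R) natrD; lra.
have hE : (h + 2).-1%:R = h%:R + 1 :> R by rewrite addn2 natr1.
have bE : b.-1%:R = b%:R - 1 :> R by rewrite -subn1 natrB // ltnW.
have bp : 0 < b%:R - 1 :> R by rewrite subr_gt0 ltr1n.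
have hp : 0 < h%:R + 1 :> R by lra.
rewrite hE bE -ln_div ?posrE // -(expRK (2^-1 : R)).
rewrite ltr_ln ?posrE ?divr_gt0 ?expR_gt0 // ltr_pdivrMr //.
have E2 : 1 <= expR (2^-1) :> R by apply: le_trans (expR_ge1Dx _); lra.
have E3 : expR (2^-1) * (th * h%:R + (2 * (e * h%:R) - 2)) <
    expR (2^-1) * (b%:R - 1).
  by rewrite ltr_pM2l ?expR_gt0 //; lra.
apply: le_lt_trans E3; rewrite mulrDr mulrA E1 mul1r.
have : 1 * (2 * (e * h%:R) - 2) <= expR (2^-1) * (2 * (e * h%:R) - 2).
  by rewrite ler_wpM2r //; lra.
lra.
Qed.

Theorem corollary5 (R : realType) (eps : R) (eps_gt0 : 0 < eps) :
  forall delta : R, 0 < delta ->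
  exists p0 : nat, forall p : nat, prime p -> (p0 <= p)%N ->
  forall U : R, p%:R `^ (2^-1 * expR (- 2^-1) + eps) <= U ->
    #|fq_exceptions p U 7|%:R <= delta * p%:R.
Proof.
move=> delta d0.
(* A smaller exponent only enlarges the range of [U], and [e <= 1 / 100] is what [exponent_choice]
   asks for. *)
pose e := Num.min eps (1 / 100).
have e0 : 0 < e by rewrite lt_min eps_gt0 divr_gt0.
have ee : e <= eps by rewrite ge_min lexx.
have e1 : e <= 1 / 100 by rewrite ge_min lexx orbT.
have [j [h [h3 he jh]]] : exists j h : nat,
    [/\ (3 < h)%N, 3 <= e * h%:R & (2 ^ j = h.*2)%N].
  pose j0 := ((Num.truncn (3 / e)).+1 + 2)%N.
  exists j0.+1, (2 ^ j0)%N; split; last by rewrite expnS mul2n.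
    by rewrite (_ : 4 = 2 ^ 2)%N // leq_exp2l // leq_addl.
  rewrite mulrC -ler_pdivrMr //; apply: le_trans (ltW (truncnS_gt _)) _.
  rewrite ler_nat; apply: leq_trans (ltnW (ltn_expl _ (ltnSn 1))).
  exact: leq_addr.
have [b [c1 c2 hb hln b1]] := exponent_choice (introT andP (conj e0 e1)) h3 he.
have [c0 c00 [P0 hP0]] := smooth_majority hb hln.
rewrite -jh in c2 b1.
have [cc cc0 hexc] := exceptions_small jh h3 c1 c2 c00.
set K := (2 ^ j)%N in hexc b1.
have K0 : (0 < K)%N by rewrite expn_gt0.
pose m := (16 * K * K)%N.
have m0 : (0 < m)%N by rewrite !muln_gt0 K0.
(* From [P1] on, [cc * P ^ (- 1 / m)] is at most [delta]. *)
pose P1 := (Num.truncn ((cc / delta) ^+ m)).+1.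
pose P2 := maxn 2 (maxn P0 P1).
exists (P2 ^ K)%N => p p_pr p_ge U hU.
(* [P] is the integer [K]-th root of [p]. From [P.+1 <= 2 * P] follows [p <= 2 ^ K * P ^ K], and
   [p >= P2 ^ K] forces [P >= P2]. *)
have [P [P_gt0 PKp pPK]] := exists_floor_root K0 (prime_gt0 p_pr).
have PP2 : (P2 <= P)%N.
  by rewrite -ltnS -(ltn_exp2r _ _ K0); apply: leq_ltn_trans pPK.
move: (PP2); rewrite !geq_max => /and3P[P_gt1 PP0 PP1].
have pb : (P ^ K <= p <= 2 ^ K * P ^ K)%N.
  rewrite PKp -expnMn (leq_trans (ltnW pPK)) // leq_exp2r //.
  by rewrite mul2n -addnn -addn1 leq_add2l.
have PU : (P ^ b)%:R <= U.
  apply: le_trans hU.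
  have -> : (P ^ b)%:R = (P ^ K)%:R `^ (b%:R / K%:R) :> R.
    rewrite natrX [in RHS]natrX -powR_mulrn // -powR_mulrn // -powRrM.
    by rewrite mulrCA divff ?mulr1 // pnatr_eq0 -lt0n.
  apply: le_trans (_ : p%:R `^ (b%:R / K%:R) <= _).
    by rewrite ge0_ler_powR ?nnegrE ?divr_ge0 // ler_nat.
  rewrite ler_powR ?ler1n ?prime_gt0 // ler_pdivrMr ?ltr0n //.
  by apply: le_trans b1 _; rewrite ler_wpM2r // lerD2l.
apply: le_trans (hexc P p P_gt1 p_pr pb (hP0 P PP0) U PU) _.
rewrite ler_wpM2r // -/m powRN.
have P0R : 0 < P%:R :> R by rewrite ltr0n.
rewrite ler_pdivrMr ?powR_gt0 // mulrC -ler_pdivrMr //.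
have q0 : 0 <= cc / delta by rewrite divr_ge0 // ltW.
rewrite -(ler_pXn2r m0) ?nnegrE ?powR_ge0 //.
rewrite -[leRHS]powR_mulrn ?powR_ge0 // -powRrM mulVf ?powRr1 ?ler0n //; last first.
  by rewrite pnatr_eq0 -lt0n.
by apply: le_trans (ltW (truncnS_gt _)) _; rewrite ler_nat.
Qed.
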